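(* Suppose Assumption A (constant $d$), Assumption M (constant $\kappa^*$) and Assumption E (constants $C_\lambda,L_\lambda$) hold, let $r>0$, and assume $(\log G_\epsilon)/m^*_\epsilon\to0$ as $\epsilon\to0$. Then: (i) with $D^*:=\lceil5L_\lambda/\kappa^*\rceil$ and $K^*:=16\big((1+1/d)\vee r/d^2\big)L_\lambda^2\big(8C_\lambda(1+1/d)\vee D^*\Lambda_{(D^* )}\big)(1\vee r)$, for every $\theta^\circ\in\Theta^r_{\mathfrak a}$, $$\lim_{\epsilon\to0}\mathbb E_{\theta^\circ}P_{\vartheta^M|Y}\big(\|\vartheta^M-\theta^\circ\|^2\le K^*\Phi^*_\epsilon\big)=1;$$ (ii) for every family $(K_\epsilon)_{\epsilon\in(0,1)}$ of positive numbers that increases as $\epsilon$ decreases and satisfies $K_\epsilon\to\infty$ as $\epsilon\to0$, $$\lim_{\epsilon\to0}\inf_{\theta^\circ\in\Theta^r_{\mathfrak a}}\mathbb E_{\theta^\circ}P_{\vartheta^M|Y}\big(\|\vartheta^M-\theta^\circ\|^2\le K_\epsilon\Phi^*_\epsilon\big)=1.$$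
   Context: Let $\ell^2$ be the space of square-summable real sequences with norm $\|\cdot\|$. Fix a bounded real sequence $\lambda=(\lambda_j)_{j\ge1}$ with $\lambda_j\ne0$ for all $j$ and a noise level $\epsilon\in(0,1)$. For a parameter $\theta^\circ$ the data $Y=(Y_j)_{j\ge1}$ satisfy $Y_j=\lambda_j\theta^\circ_j+\sqrt\epsilon\,\xi_j$ with $\xi_j$ i.i.d. $N(0,1)$; $\mathbb E_{\theta^\circ}$ denotes expectation under this law. Fix prior means $\eta=(\eta_j)_{j\ge1}$ and prior variances $\tau_j\in(0,\infty)$ (possibly depending on $\epsilon$). For $m\in\mathbb N$ the sieve prior is the law of $\vartheta^m$ with independent coordinates, $\vartheta^m_j\sim N(\eta_j,\tau_j)$ for $j\le m$ and $\vartheta^m_j=\eta_j$ a.s. for $j>m$; put $\sigma_j:=(\lambda_j^2\epsilon^{-1}+\tau_j^{-1})^{-1}$, $\theta^Y_j:=\sigma_j(\tau_j^{-1}\eta_j+\lambda_j\epsilon^{-1}Y_j)$; the posterior $P_{\vartheta^m|Y}$ makes the coordinates independent with $\vartheta^m_j\sim N(\theta^Y_j,\sigma_j)$ for $j\le m$ and $\vartheta^m_j=\eta_j$ for $j>m$; $\hat\theta^m_j:=\theta^Y_j$ for $j\le m$, $\hat\theta^m_j:=\eta_j$ for $j>m$. Let $\Lambda_j:=\lambda_j^{-2}$, $\Lambda_{(m)}:=\max_{1\le j\le m}\Lambda_j$, $\bar\Lambda_m:=m^{-1}\sum_{j=1}^m\Lambda_j$. Let $G_\epsilon:=\max\{1\le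 m\le\lfloor\epsilon^{-1}\rfloor:\epsilon\Lambda_{(m)}\le\Lambda_1\}$. Assumption A: there is $d>0$ with $\tau_j\ge d\,(\epsilon^{1/2}\Lambda_j^{1/2}\vee\epsilon\Lambda_j)$ for all $1\le j\le G_\epsilon$, $\epsilon\in(0,1)$. Assumption E: there are constants $C_\lambda\ge1$, $L_\lambda\ge1$ such that for all $k,l\in\mathbb N$: (i) $\sup_{j>k}\lambda_j^2\le C_\lambda\min_{1\le j\le k}\lambda_j^2=C_\lambda\Lambda_{(k)}^{-1}$; (ii) $\Lambda_{(kl)}\le\Lambda_{(k)}\Lambda_{(l)}$; (iii) $\Lambda_{(k)}/\bar\Lambda_k\le L_\lambda$. Let $\mathfrak a=(\mathfrak a_j)_{j\ge1}$ be strictly positive, non-increasing, with $\mathfrak a_1=1$ and $\mathfrak a_j\to0$; for $r>0$, $\Theta^r_{\mathfrak a}:=\{\theta:\sum_{j\ge1}(\theta_j-\eta_j)^2/\mathfrak a_j\le r\}$. Let $m^*_\epsilon:=\min\{m\ge1:\mathfrak a_m\vee\epsilon m\bar\Lambda_m\le\mathfrak a_k\vee\epsilon k\bar\Lambda_k\ \forall k\ge1\}$ and $\Phi^*_\epsilon:=\mathfrak a_{m^*_\epsilon}\vee\epsilon m^*_\epsilon\bar\Lambda_{m^*_\epsilon}$. Fix $\epsilon_o\in(0,1)$. Assumption M: $\kappa^*:=\inf_{0<\epsilon<\epsilon_o}(\Phi^*_\epsilon)^{-1}[\mathfrak a_{m^*_\epsilon}\wedge\epsilon m^*_\epsilon\bar\Lambda_{m^*_\epsilon}]>0$.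 Hierarchical prior: a random dimension $M$ with values in $\{1,\dots,G_\epsilon\}$ and $P(M=m)\propto\exp(-3C_\lambda m/2)\prod_{j=1}^m(\tau_j/\sigma_j)^{1/2}$; conditionally on $M=m$ the parameter $\vartheta^M$ has the law of $\vartheta^m$, and $Y_j=\lambda_j\vartheta^M_j+\sqrt\epsilon\xi_j$. The posterior of $M$ is $P_{M|Y}(M=m)=\exp(\frac12\{\|\hat\theta^m-\eta\|_\sigma^2-3C_\lambda m\})/\sum_{k=1}^{G_\epsilon}\exp(\frac12\{\|\hat\theta^k-\eta\|_\sigma^2-3C_\lambda k\})$ with $\|x\|_\sigma^2:=\sum_j x_j^2/\sigma_j$, and the posterior of $\vartheta^M$ is the mixture $P_{\vartheta^M|Y}=\sum_{m=1}^{G_\epsilon}P_{M|Y}(M=m)\,P_{\vartheta^m|Y}$. *)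

(* Defs.v *)
From HB Require Import structures.
From mathcomp Require Import all_boot all_order all_algebra.
From mathcomp Require Import all_classical all_reals all_analysis.
From mathcomp Require Import normal_distribution.

Set Implicit Arguments.
Unset Strict Implicit.
Unset Printing Implicit Defensive.

Import Order.TTheory GRing.Theory Num.Theory.
Import numFieldNormedType.Exports.

Local Open Scope classical_set_scope.
Local Open Scope ring_scope.

(* Convention: all sequences are [nat -> R] and are 1-indexed as in the
   paper: only the coordinates j >= 1 are meaningful, coordinate 0 is
   ignored everywhere. *)

Section Defs.
Variable R : realType.

Definition Lam (lam : nat -> R) (j : nat) : R := (lam j ^+ 2)^-1.

Definition LamMax (lam : nat -> R) (m : nat) : R :=
  \big[Num.max/0]_(1 <= j < m.+1) Lam lam j.

Definition LamBar (lam : nat -> R) (m : nat) : R :=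
  (\sum_(1 <= j < m.+1) Lam lam j) / m%:R.

Definition Gdim (lam : nat -> R) (eps : R) : nat :=
  (\max_(1 <= m < (Num.truncn (eps^-1)).+1 | (eps * LamMax lam m <= Lam lam 1)%R) m)%N.

(* sigma_j := (lambda_j^2/eps + 1/tau_j)^{-1}; here tau is the sequence of
   prior variances for the given eps *)
Definition sig (lam tau : nat -> R) (eps : R) (j : nat) : R :=
  (lam j ^+ 2 / eps + (tau j)^-1)^-1.

Definition thetaY (lam eta tau : nat -> R) (eps : R) (Y : nat -> R) (j : nat) : R :=
  sig lam tau eps j * ((tau j)^-1 * eta j + lam j * eps^-1 * Y j).

Definition thetaHat (lam eta tau : nat -> R) (eps : R) (Y : nat -> R) (m j : nat) : R :=
  if (j <= m)%N then thetaY lam eta tau eps Y j else eta j.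

(* || hat theta^m - eta ||_sigma^2 ; the coordinates j > m of
   hat theta^m - eta vanish, so the series reduces to a finite sum *)
Definition normsig (lam eta tau : nat -> R) (eps : R) (Y : nat -> R) (m : nat) : R :=
  \sum_(1 <= j < m.+1)
     (thetaHat lam eta tau eps Y m j - eta j) ^+ 2 / sig lam tau eps j.

Definition postM (lam eta tau : nat -> R) (Cl eps : R) (Y : nat -> R) (m : nat) : R :=
  expR ((normsig lam eta tau eps Y m - 3 * Cl * m%:R) / 2) /
  \sum_(1 <= k < (Gdim lam eps).+1)
     expR ((normsig lam eta tau eps Y k - 3 * Cl * k%:R) / 2).

Definition upd (y : nat -> R) (i : nat) (x : R) : nat -> R :=
  fun j => if j == i then x else y j.

(* Iterated Gaussian integral: integral of f(v) where the coordinates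
   v_1, ..., v_m are independent with v_j ~ N(mean_j, var_j) and
   v_j = rest_j for every other j. *)
Fixpoint gaussIter (mean var rest : nat -> R) (m : nat)
    (f : (nat -> R) -> \bar R) {struct m} : \bar R :=
  match m with
  | 0 => f rest
  | k.+1 => (\int[normal_prob (mean k.+1) (Num.sqrt (var k.+1))]_x
               gaussIter mean var rest k (fun y => f (upd y k.+1 x)))%E
  end.

Definition gaussSeqProb (mean var rest : nat -> R) (m : nat)
    (B : set (nat -> R)) : \bar R :=
  gaussIter mean var rest m (fun v => (\1_B v)%:E).

Definition sqnorm (x : nat -> R) : \bar R :=
  (\sum_(1 <= j <oo) ((x j) ^+ 2)%:E)%E.

Definition postSieve (lam eta tau : nat -> R) (eps : R) (Y : nat -> R) (m : nat)
    (B : set (nat -> R)) : \bar R :=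
  gaussSeqProb (thetaY lam eta tau eps Y) (sig lam tau eps) eta m B.

Definition postHier (lam eta tau : nat -> R) (Cl eps : R) (Y : nat -> R)
    (B : set (nat -> R)) : \bar R :=
  (\sum_(1 <= m < (Gdim lam eps).+1)
     (postM lam eta tau Cl eps Y m)%:E * postSieve lam eta tau eps Y m B)%E.

Definition inTheta (a eta : nat -> R) (r : R) (th : nat -> R) : Prop :=
  (\sum_(1 <= j <oo) (((th j - eta j) ^+ 2 / a j)%:E) <= r%:E)%E.

Definition crit (a lam : nat -> R) (eps : R) (m : nat) : R :=
  Num.max (a m) (eps * m%:R * LamBar lam m).

Definition is_mstar (a lam : nat -> R) (eps : R) (m : nat) : Prop :=
  [/\ (1 <= m)%N,
      (forall k, (1 <= k)%N -> crit a lam eps m <= crit a lam eps k) &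
      (forall m', (1 <= m')%N ->
         (forall k, (1 <= k)%N -> crit a lam eps m' <= crit a lam eps k) ->
         (m <= m')%N)].

Definition mstar (a lam : nat -> R) (eps : R) : nat := xget 0%N (is_mstar a lam eps).

Definition Phistar (a lam : nat -> R) (eps : R) : R := crit a lam eps (mstar a lam eps).

Definition kappastar (a lam : nat -> R) (eo : R) : R :=
  inf [set (Phistar a lam e)^-1 *
           Num.min (a (mstar a lam e)) (e * (mstar a lam e)%:R * LamBar lam (mstar a lam e))
      | e in [set e : R | 0 < e < eo]].

Definition Dstar (a lam : nat -> R) (eo Ll : R) : nat :=
  absz (Num.ceil (5 * Ll / kappastar a lam eo)).

Definition Kstar (a lam : nat -> R) (eo d r Cl Ll : R) : R :=
  16 * Num.max (1 + d^-1) (r / d ^+ 2) * Ll ^+ 2 *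
  Num.max (8 * Cl * (1 + d^-1))
          ((Dstar a lam eo Ll)%:R * LamMax lam (Dstar a lam eo Ll)) *
  Num.max 1 r.

Definition iid_std_normal (dT : measure_display) (T : measurableType dT)
    (P : probability T R) (xi : nat -> T -> R) : Prop :=
  [/\ (forall j, measurable_fun setT (xi j)),
      (forall j (A : set R), measurable A -> P (xi j @^-1` A) = normal_prob 0 1 A) &
      (forall s : seq nat, uniq s -> forall A : nat -> set R,
          (forall j, measurable (A j)) ->
          P (\bigcap_(j in [set j | j \in s]) (xi j @^-1` A j)) =
          (\big[*%E/1%E]_(j <- s) P (xi j @^-1` A j))%E)].

Definition dataY (lam th : nat -> R) (eps : R) (T : Type) (xi : nat -> T -> R) (w : T) : nat -> R :=
  fun j => lam j * th j + Num.sqrt eps * xi j w.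

(* E_{theta}[ P_{theta^M|Y}( ||theta^M - theta||^2 <= c Phi^*_eps ) ], where
   tau eps is the sequence of prior variances at noise level eps *)
Definition postE (dT : measure_display) (T : measurableType dT)
    (P : probability T R) (xi : nat -> T -> R)
    (a lam eta : nat -> R) (tau : R -> nat -> R) (Cl : R)
    (th : nat -> R) (c : R) (eps : R) : \bar R :=
  (\int[P]_w
     postHier lam eta (tau eps) Cl eps (dataY lam th eps xi w)
       [set v : nat -> R | (sqnorm (fun j => (v j - th j)%R) <= ((c * Phistar a lam eps)%R)%:E)%E])%E.
End Defs.

(* Main.v *)
Require Import Defs.
From HB Require Import structures.
From mathcomp Require Import all_boot all_order all_algebra.
From mathcomp Require Import all_classical all_reals all_analysis.
From mathcomp Require Import measurable_realfun normal_distribution.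
From mathcomp Require Import ring lra.

(* Write b = theta - eta, s_j = sigma_j lambda_j^2 / eps and let n be the
   minimax dimension [mstar].  For every dimension m <= G the P-expectation of
   P(M = m | Y) P(vartheta^m outside the ball | Y) is at most
   A exp(- n / 8) with A = exp(r / (4 d^2)); as log G = o(n), the sum over m
   tends to 0, uniformly in theta.  Three regimes are distinguished.
   - m < n and sum_(m < j <= n) b_j^2 large: P(M = m | Y) is at most its
     ratio to P(M = n | Y), and the lost bias beats the penalty gained.
   - m > D n: P(M = m | Y) is at most the square root of that ratio.  The root
     is what makes the exponential moments of the s_j (beta_j + xi_j)^2 finite
     uniformly in s_j <= 1; now the penalty wins.
   - otherwise the bias is controlled and P(vartheta^m outside the ball | Y) is
     handled by an exponential Markov inequality, first under the posterior and
     then under P.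
   Only sum_(n < j) b_j^2 <= rho a_n matters for D.  On the whole ellipsoid
   rho = r, which the constant Dstar cannot absorb; for a fixed theta the tail of a
   convergent series makes rho arbitrarily small as n grows, and this is why
   (i) is pointwise while (ii) needs K_eps -> oo. *)

Import Order.TTheory GRing.Theory Num.Theory.
Import numFieldNormedType.Exports.

Local Open Scope classical_set_scope.
Local Open Scope ring_scope.

Set Implicit Arguments.
Unset Strict Implicit.

(** * Integration of nonnegative functions against a law or a density *)

Section nonnegative_integrals.
Local Open Scope ereal_scope.
Context d (T : measurableType d) (R : realType).
Variable mu : {measure set T -> \bar R}.

(** Measurability is avoided because the integral of a nonnegative function is a supremum over the
    simple functions below it. This matters for posterior probabilities of a ball, whose
    measurability in the data is never established. *)
Lemma ge0_le_integral_nomeas (f g : T -> \bar R) :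
  (forall x, 0 <= f x) -> (forall x, f x <= g x) ->
  \int[mu]_x f x <= \int[mu]_x g x.
Proof.
move=> f0 fg.
have g0 x : 0 <= g x by exact: le_trans (f0 x) (fg x).
rewrite !ge0_integralTE//; apply: ge_ereal_sup => _ [h hf <-].
by apply: ereal_sup_ubound; exists h => // x; exact: le_trans (hf x) (fg x).
Qed.

Import HBNNSimple.

(** Indicators extend to [g] through simple functions and monotone convergence. It serves twice:
    with [X] the identity and [Z] a normal density, and with [X] one noise variable and [Z] a
    product of factors in the others, where the hypothesis expresses independence. *)
Lemma ge0_integral_density (X : T -> measurableTypeR R) (Z : T -> R)
    (nu : {measure set (measurableTypeR R) -> \bar R}) (c : R) :
  measurable_fun setT X -> measurable_fun setT Z -> (forall x, (0 <= Z x)%R) ->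
  (forall A, measurable A ->
    \int[mu]_x ((\1_A (X x))%:E * (Z x)%:E) = c%:E * nu A) ->
  forall g : measurableTypeR R -> R, measurable_fun setT g -> (forall x, (0 <= g x)%R) ->
  \int[mu]_x ((g (X x))%:E * (Z x)%:E) = c%:E * \int[nu]_y (g y)%:E.
Proof.
move=> mX mZ Z0 XA g mg g0.
have mEZ : measurable_fun setT (EFin \o Z) by exact/measurable_EFinP.
have EZ0 x : 0 <= (Z x)%:E by rewrite lee_fin.
have mEg : measurable_fun setT (EFin \o g) by exact/measurable_EFinP.
pose h := nnsfun_approx measurableT mEg.
have hg x : (EFin \o h n) x @[n --> \oo] --> (g x)%:E.
  apply: (cvg_nnsfun_approx measurableT mEg) => // y _.
  by rewrite /= lee_fin.
have mh n : measurable_fun setT (h n) by [].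
have hnd x : nondecreasing_seq (fun n => (h n x)%:E).
  by move=> a b ab; rewrite lee_fin; exact/lefP/nd_nnsfun_approx.
have -> : \int[nu]_y (g y)%:E = limn (fun n => \int[nu]_y (h n y)%:E).
  rewrite -monotone_convergence//.
  - by apply: eq_integral => y _; apply/esym/cvg_lim => //; exact: hg.
  - by move=> n; exact/measurable_EFinP.
  - by move=> n x _; rewrite lee_fin.
have cvgnu : cvgn (fun n => \int[nu]_y (h n y)%:E).
  apply: ereal_nondecreasing_is_cvgn => a b ab.
  apply: ge0_le_integral => //.
  - by move=> x _; rewrite lee_fin.
  - exact/measurable_EFinP.
  - exact/measurable_EFinP.
  - by move=> x _; exact: hnd.
have -> : \int[mu]_x ((g (X x))%:E * (Z x)%:E) =
    limn (fun n => \int[mu]_x ((h n (X x))%:E * (Z x)%:E)).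
  rewrite -monotone_convergence//.
  - apply: eq_integral => x _; apply/esym/cvg_lim => //.
    by apply: cvgeZr; [|exact: hg].
  - move=> n; apply: emeasurable_funM => //; apply/measurable_EFinP.
    exact: measurableT_comp.
  - by move=> n x _; rewrite mule_ge0// lee_fin.
  - by move=> x _ a b ab; rewrite lee_wpmul2r//; exact: hnd.
rewrite -limeMl//.
congr (limn _); apply/funext => n.
have muleindic_ge0 r x : 0 <= (r * \1_(h n @^-1` [set r]) x)%:E.
  exact: nnfun_muleindic_ge0.
transitivity (\int[mu]_x (\sum_(y \in range (h n))
    (y * \1_(h n @^-1` [set y]) (X x))%:E * (Z x)%:E)).
  apply: eq_integral => x _.
  rewrite -ge0_mule_fsuml//.
  by rewrite fsumEFin // -(fimfunE _ (X x)).
have mindic r : measurable_fun setT (fun x => (r * \1_(h n @^-1` [set r]) (X x))%:E).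
  apply/measurable_EFinP/measurable_funM => //.
  by apply: (measurableT_comp _ mX); exact: measurable_indic.
rewrite ge0_integral_fsum//; last 2 first.
  - by move=> r; apply: emeasurable_funM.
  - by move=> r x _; rewrite mule_ge0.
transitivity (c%:E * \int[nu]_x (\sum_(y \in range (h n))
    (y * \1_(h n @^-1` [set y]) x)%:E)); last first.
  by congr (_ * _); apply: eq_integral => x _; rewrite fsumEFin // -fimfunE.
rewrite ge0_integral_fsum//; last first.
  by move=> r; apply/measurable_EFinP/measurable_funM.
have intge0 r : 0 <= \int[nu]_x (r * \1_(h n @^-1` [set r]) x)%:E.
  by apply: integral_ge0 => x _.
rewrite ge0_mule_fsumr//.
apply: eq_fsbigr => r rhn.
have r0 : (0 <= r)%R by move: rhn; rewrite inE => -[t _ <-].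
under eq_integral do rewrite EFinM -muleA.
have mhr : measurable (h n @^-1` [set r]) by exact: measurable_sfunP.
rewrite ge0_integralZl//; last 2 first.
  - apply: emeasurable_funM => //; apply/measurable_EFinP.
    by apply: (measurableT_comp _ mX); exact: measurable_indic.
  - by move=> x _; rewrite mule_ge0// lee_fin.
rewrite XA//.
under [in RHS]eq_integral do rewrite EFinM.
rewrite ge0_integralZl//; last first.
  exact/measurable_EFinP/measurable_indic.
by rewrite integral_indic// setIT muleCA.
Qed.

End nonnegative_integrals.

(** * Exponential moments of squares of Gaussian variables *)

Section gaussian_exponential_moments.
Variable R : realType.
Implicit Types m s t th k a b x y : R.

Lemma measurable_expR_sqr t a b :
  measurable_fun setT (fun x : R => expR (t * (a * x + b) ^+ 2)).
Proof.
apply: measurableT_comp => //=; apply: measurable_funM => //=.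
by apply: measurable_funX => //=; apply: measurable_funD.
Qed.

Lemma ge0_integral_normal_prob m s (g : R -> R) :
  measurable_fun setT g -> (forall x, 0 <= g x) ->
  (\int[normal_prob m s]_x (g x)%:E =
   \int[lebesgue_measure]_x (g x * normal_pdf m s x)%:E)%E.
Proof.
move=> mg g0.
have := @ge0_integral_density _ _ R (@lebesgue_measure R) id (normal_pdf m s)
  (normal_prob m s : {measure set (measurableTypeR R) -> \bar R}) 1.
move=> /(_ _ _ _ _ g mg g0); rewrite mul1e => <- //.
- exact: measurable_normal_pdf.
- by move=> x; exact: normal_pdf_ge0.
- move=> A mA; rewrite mul1e /normal_prob [RHS]integral_mkcond.
  by apply: eq_integral => x _; rewrite epatch_indic muleC.
Qed.

(** Completing the square: the exponential tilt of a normal density is a constant times another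
    normal density, so the exponential moment is that constant. *)
Lemma normal_pdf_tilt m s t th x : 0 < s -> 0 < 1 - 2 * t * s ^+ 2 ->
  let k := 1 - 2 * t * s ^+ 2 in
  expR (t * (x - th) ^+ 2) * normal_pdf m s x =
  ((Num.sqrt k)^-1 * expR (t * (m - th) ^+ 2 / k)) *
  normal_pdf ((m - 2 * t * s ^+ 2 * th) / k) (s / Num.sqrt k) x.
Proof.
move=> s0 k0 k.
have sk0 : 0 < Num.sqrt k by rewrite sqrtr_gt0.
have ssk0 : s / Num.sqrt k != 0 by rewrite gt_eqF// divr_gt0.
have s2 : (s / Num.sqrt k) ^+ 2 = s ^+ 2 / k by rewrite expr_div_n sqr_sqrtr// ltW.
rewrite !normal_pdfE//; last by rewrite gt_eqF.
have -> : normal_peak (s / Num.sqrt k) = Num.sqrt k * normal_peak s.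
  rewrite /normal_peak s2 -[Num.sqrt k]invrK -invfM -(@sqrtrV _ k) ?ltW// -sqrtrM.
    by congr ((Num.sqrt _)^-1); ring.
  by rewrite invr_ge0 ltW.
have k' : k != 0 by rewrite gt_eqF.
suff E : expR (t * (x - th) ^+ 2) * normal_fun m s x = expR (t * (m - th) ^+ 2 / k) *
    normal_fun ((m - 2 * t * s ^+ 2 * th) / k) (s / Num.sqrt k) x.
  by rewrite mulrCA E; field; rewrite gt_eqF.
rewrite /normal_fun -!expRD s2; congr expR.
have s' : s != 0 by rewrite gt_eqF.
rewrite /k in k' *; field.
by rewrite k' s'.
Qed.

Lemma integral_normal_prob_exp_sqr m s t th : 0 < s -> 0 < 1 - 2 * t * s ^+ 2 ->
  let k := 1 - 2 * t * s ^+ 2 in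
  (\int[normal_prob m s]_x (expR (t * (x - th) ^+ 2))%:E =
   ((Num.sqrt k)^-1 * expR (t * (m - th) ^+ 2 / k))%:E)%E.
Proof.
move=> s0 k0 k.
rewrite ge0_integral_normal_prob; last 2 first.
- have -> : (fun x : R => expR (t * (x - th) ^+ 2)) = fun x => expR (t * (1 * x - th) ^+ 2).
    by apply/funext => x; rewrite mul1r.
  exact: measurable_expR_sqr.
- by move=> x; exact: expR_ge0.
under eq_integral do rewrite normal_pdf_tilt//.
under eq_integral do rewrite EFinM.
rewrite ge0_integralZl//.
- by rewrite integral_normal_pdf mule1.
- by apply: measurableT_comp => //; exact: measurable_normal_pdf.
- by move=> x _; rewrite lee_fin normal_pdf_ge0.
Qed.

Lemma integral_std_normal_exp_sqr t a b : a != 0 -> 0 < 1 - 2 * t * a ^+ 2 ->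
  let k := 1 - 2 * t * a ^+ 2 in
  (\int[normal_prob 0 1]_x (expR (t * (a * x + b) ^+ 2))%:E =
   ((Num.sqrt k)^-1 * expR (t * b ^+ 2 / k))%:E)%E.
Proof.
move=> a0 k0 k.
transitivity (\int[normal_prob 0 1]_x
    (expR (t * a ^+ 2 * (x - (- b / a)) ^+ 2))%:E)%E.
  by apply: eq_integral => x _; congr (expR _)%:E; field.
have := @integral_normal_prob_exp_sqr 0 1 (t * a ^+ 2) (- b / a) ltr01.
rewrite (_ : 2 * (t * a ^+ 2) * 1 ^+ 2 = 2 * t * a ^+ 2); last by ring.
move=> H; rewrite [LHS]H//.
have -> : t * a ^+ 2 * (0 - - b / a) ^+ 2 = t * b ^+ 2 by field.
by [].
Qed.

(** Square root of [1 + 2 * y <= expR (2 * y)]. It puts the normalising factor into the exponent,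
    where bounds over coordinates add up. *)
Lemma invr_sqrt_le_expR k y : 0 < k -> k^-1 <= 1 + 2 * y -> (Num.sqrt k)^-1 <= expR y.
Proof.
move=> k0 ky; rewrite -sqrtrV; last exact: ltW.
have -> : expR y = Num.sqrt (expR y ^+ 2).
  by rewrite sqrtr_sqr ger0_norm// expR_ge0.
rewrite ler_sqrt ?exprn_ge0 ?expR_ge0// (le_trans ky)//.
have -> : expR y ^+ 2 = expR (2 * y) by rewrite expr2 -expRD mulr_natl mulr2n.
exact: expR_ge1Dx.
Qed.

Lemma integral_std_normal_exp_sqr_le t a b y z : a != 0 -> 0 < 1 - 2 * t * a ^+ 2 ->
  (1 - 2 * t * a ^+ 2)^-1 <= 1 + 2 * y -> t * b ^+ 2 / (1 - 2 * t * a ^+ 2) <= z ->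
  (\int[normal_prob 0 1]_x (expR (t * (a * x + b) ^+ 2))%:E <= (expR (y + z))%:E)%E.
Proof.
move=> a0 k0 ky kz; rewrite integral_std_normal_exp_sqr// lee_fin expRD.
rewrite ler_pM ?expR_ge0 ?invr_ge0//; last by rewrite ler_expR.
exact: invr_sqrt_le_expR.
Qed.

Lemma integral_normal_exp_sqr_le m s t th : 0 < s -> 0 <= t -> t * s ^+ 2 <= 1 / 8 ->
  (\int[normal_prob m s]_x (expR (t * (x - th) ^+ 2))%:E <=
   (expR (1 / 4 + 4 / 3 * t * (m - th) ^+ 2))%:E)%E.
Proof.
move=> s0 t0 ts.
(* The inverse is then at most 4/3, below the 1 + 2/4 needed for the term 1/4 in the exponent. *)
have k0 : 3 / 4 <= 1 - 2 * t * s ^+ 2 by lra.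
have k1 : 0 < 1 - 2 * t * s ^+ 2 by lra.
rewrite integral_normal_prob_exp_sqr// lee_fin expRD.
have kV : (1 - 2 * t * s ^+ 2)^-1 <= 4 / 3.
  by rewrite -[4 / 3]invrK lef_pV2 ?posrE//; lra.
rewrite ler_pM ?expR_ge0 ?invr_ge0//.
- by apply: invr_sqrt_le_expR => //; apply: le_trans kV _; lra.
- by rewrite ler_expR mulrC mulrA ler_wpM2r ?sqr_ge0// ler_wpM2r.
Qed.

End gaussian_exponential_moments.

(** * Expectations of products of functions of independent noise variables *)

Section products_of_independent_variables.
Context (R : realType) (dT : measure_display) (T : measurableType dT).
Variables (P : probability T R) (xi : nat -> T -> R).
Hypothesis hxi : iid_std_normal P xi.

(** Mixing general factors with indicators makes the induction work: the law of one coordinate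
    weighted by the remaining factors is tested on sets [B], which turns its factor [g j] into an
    indicator and leaves one general factor fewer. With indicators only, the claim is the definition
    of independence. *)
Lemma iid_integral_prod_indic (g : nat -> R -> R) (M : nat -> R) :
  (forall j, measurable_fun setT (g j)) -> (forall j x, 0 <= g j x) ->
  (forall j, (\int[normal_prob 0 1]_x (g j x)%:E = (M j)%:E)%E) ->
  forall (s1 s2 : seq nat) (A : nat -> set R), uniq (s1 ++ s2) ->
  (forall j, measurable (A j)) ->
  (\int[P]_w ((\prod_(j <- s1) g j (xi j w)) *
              \prod_(j <- s2) \1_(A j) (xi j w))%:E =
   ((\prod_(j <- s1) M j) * \prod_(j <- s2) fine (normal_prob 0 1 (A j)))%:E)%E.
Proof.
move=> mg g0 gM; case: hxi => mxi lawxi indep.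
have mpre j (B : set R) : measurable B -> measurable (xi j @^-1` B).
  by move=> mB; rewrite -[X in measurable X]setTI; exact: mxi.
have Nfin (B : set R) : measurable B -> normal_prob 0 1 B \is a fin_num.
  by move=> mB; rewrite -(lawxi 0%N)//; apply: fin_num_measure; exact: mpre.
have mprodg (s : seq nat) : measurable_fun setT (fun w => \prod_(j <- s) g j (xi j w)).
  by apply: measurable_prod => j _; exact: measurableT_comp.
have mprodA (s : seq nat) (A : nat -> set R) : (forall j, measurable (A j)) ->
    measurable_fun setT (fun w => \prod_(j <- s) \1_(A j) (xi j w) : R).
  move=> mA; apply: measurable_prod => j _.
  by apply: (measurableT_comp _ (mxi j)); exact: measurable_indic.
elim=> [|j s1 ih] s2 A us mA.
  under eq_integral do rewrite big_nil mul1r.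
  rewrite big_nil mul1r.
  transitivity (\int[P]_w (\1_(\bigcap_(j in [set j | j \in s2]) (xi j @^-1` A j)) w)%:E)%E.
    apply: eq_integral => w _; congr EFin.
    rewrite indicE; case: (boolP (w \in _)) => [/set_mem wA|/negP wA].
      rewrite big_seq big1// => j js2; rewrite indicE mem_set//.
      exact: (wA j js2).
    have [j js2 wAj] : exists2 j, j \in s2 & ~ A j (xi j w).
      apply: contra_notP wA => wA; apply/mem_set => j /= js2.
      by apply: contra_notP wA => wA; exists j.
    rewrite (big_rem j)//= indicE (_ : _ \in _ = false) ?mul0r//.
    by apply/negP => /set_mem.
  rewrite integral_indic ?setIT//; last first.
    apply: bigcap_measurableType => k _.
    exact: mpre.
  rewrite [LHS](indep s2 us A mA).
  elim: {us} s2 => [|j s2 ih]; first by rewrite !big_nil.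
    by rewrite !big_cons ih EFinM lawxi// fineK// Nfin.
move: us => /= /andP[js12 us].
under eq_integral do rewrite big_cons -mulrA EFinM.
rewrite big_cons -mulrA mulrC EFinM -gM.
apply: (@ge0_integral_density _ T R P (xi j) (fun w => (\prod_(j <- s1) g j (xi j w)) *
              \prod_(j <- s2) \1_(A j) (xi j w))
              (normal_prob 0 1 : {measure set (measurableTypeR R) -> \bar R})).
- exact: mxi.
- by apply: measurable_funM; [exact: mprodg|exact: mprodA].
- by move=> w; rewrite mulr_ge0 ?prodr_ge0.
- move=> B mB.
  (* Overwriting the set at [j] changes no other factor, since [j] occurs neither in [s1] nor in
     [s2]. *)
  pose A' i : set R := if i == j then B else A i.
  have jn i : i \in s1 ++ s2 -> (i == j) = false.
    by move=> is12; apply: contraNF js12 => /eqP <-.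
  have A'E (F : nat -> set R -> R) :
      \prod_(i <- s2) F i (A' i) = \prod_(i <- s2) F i (A i).
    rewrite big_seq [RHS]big_seq; apply: eq_bigr => i is2.
    by rewrite /A' jn// mem_cat is2 orbT.
  have uA' : uniq (s1 ++ j :: s2).
    by rewrite uniq_catC/= mem_cat orbC -mem_cat js12 uniq_catC.
  have mA' i : measurable (A' i : set R).
    by rewrite /A'; case: ifP => _; [exact: mB|exact: mA].
  transitivity (\int[P]_w ((\prod_(i <- s1) g i (xi i w)) *
      \prod_(i <- j :: s2) \1_(A' i) (xi i w))%:E)%E.
    apply: eq_integral => w _.
    rewrite big_cons (A'E (fun i A => \1_A (xi i w))) /A' eqxx -EFinM.
    by rewrite mulrCA.
  rewrite ih// big_cons (A'E (fun i A => fine (normal_prob 0 1 A))) mulrCA {1}/A' eqxx.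
  by rewrite EFinM muleC fineK// Nfin.
- exact: mg.
- exact: g0.
Qed.

Lemma iid_integral_prod (g : nat -> R -> R) (M : nat -> R) (s : seq nat) : uniq s ->
  (forall j, measurable_fun setT (g j)) -> (forall j x, 0 <= g j x) ->
  (forall j, j \in s -> (\int[normal_prob 0 1]_x (g j x)%:E <= (M j)%:E)%E) ->
  (\int[P]_w (\prod_(j <- s) g j (xi j w))%:E <= (\prod_(j <- s) M j)%:E)%E.
Proof.
move=> us mg g0 gM.
(* Off [s] nothing bounds the integral of [g j]; replacing it by 0 makes every moment finite, as the
   exact product formula requires. *)
pose g' j x := if j \in s then g j x else 0.
pose M' j := fine (\int[normal_prob 0 1]_x (g' j x)%:E)%E.
have g'0 j x : 0 <= g' j x by rewrite /g'; case: ifP.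
have g'E j : j \in s -> g' j = g j by move=> js; apply/funext => x; rewrite /g' js.
have I0 j : (0 <= \int[normal_prob 0 1]_x (g' j x)%:E)%E.
  by apply: integral_ge0 => x _; rewrite lee_fin.
have gM' j : (\int[normal_prob 0 1]_x (g' j x)%:E = (M' j)%:E)%E.
  rewrite fineK// ge0_fin_numE//.
  have [js|js] := boolP (j \in s).
    by rewrite g'E//; apply: (le_lt_trans (gM _ js)); rewrite ltry.
  by rewrite integral0_eq// => x _; rewrite /g' (negbTE js).
have mg' j : measurable_fun setT (g' j) by rewrite /g'; case: (j \in s).
have := @iid_integral_prod_indic g' M' mg' g'0 gM' s [::] (fun=> setT).
rewrite cats0 big_nil mulr1 => H.
rewrite (_ : (\int[P]_w _ = (\prod_(j <- s) M' j)%:E)%E).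
  rewrite lee_fin big_seq [leRHS]big_seq; apply: ler_prod => j js.
  rewrite -!lee_fin -gM' I0 (le_trans _ (gM _ js))//.
  by under eq_integral do rewrite g'E//.
rewrite -H//; apply: eq_integral => w _.
rewrite big_nil mulr1 big_seq [in RHS]big_seq; congr EFin.
by apply: eq_bigr => j js; rewrite g'E.
Qed.

End products_of_independent_variables.

(** * Lower bounds for expectations of functions close to 1 *)

Section expectation_bounds.
Local Open Scope ereal_scope.
Context d (T : measurableType d) (R : realType) (Q : probability T R).

(** Since [F] need not be measurable, linearity is applied to the measurable minorant
    [max 0 (1 - H)] instead. *)
Lemma expectation_ge1B (F : T -> \bar R) (H : T -> R) (h : R) :
  (forall x, 0 <= F x) -> measurable_fun setT H -> (forall x, (0 <= H x)%R) ->
  (forall x, (1 - H x)%:E <= F x) -> \int[Q]_x (H x)%:E <= h%:E ->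
  (1 - h)%:E <= \int[Q]_x F x.
Proof.
move=> F0 mH H0 HF Hh.
pose l x := Num.max 0%R (1 - H x)%R.
have l0 x : (0 <= l x)%R by rewrite le_max lexx.
have ml : measurable_fun setT l.
  by apply: measurable_maxr => //; apply: measurable_funB.
apply: (@le_trans _ _ (\int[Q]_x (l x)%:E)); last first.
  apply: ge0_le_integral_nomeas => x; first by rewrite lee_fin.
  by rewrite /l EFin_max ge_max; apply/andP; split; [exact: F0|exact: HF].
rewrite EFinB leeBlDr//.
apply: (@le_trans _ _ (\int[Q]_x (l x)%:E + \int[Q]_x (H x)%:E)); last exact: leeD.
rewrite -ge0_integralD//;
  do ?[exact/measurable_EFinP | by move=> x _; rewrite lee_fin].
apply: (@le_trans _ _ (\int[Q]_x (cst 1 x))).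
  by rewrite integral_cst//= probability_setT mule1.
apply: ge0_le_integral_nomeas => x //=.
by rewrite -EFinD lee_fin -lerBlDr le_max lexx orbT.
Qed.

Lemma expectation_le1 (F : T -> \bar R) :
  (forall x, 0 <= F x) -> (forall x, F x <= 1) -> \int[Q]_x F x <= 1.
Proof.
move=> F0 F1; apply: (@le_trans _ _ (\int[Q]_x (cst 1 x))).
  exact: ge0_le_integral_nomeas.
by rewrite integral_cst//= probability_setT mule1.
Qed.

End expectation_bounds.

(** * Bounds for the iterated Gaussian integral *)

Section iterated_gaussian_integral.
Local Open Scope ereal_scope.
Variable R : realType.
Implicit Types (mean var rest : nat -> R) (f : (nat -> R) -> \bar R).

Lemma gaussIter_ge0 mean var rest m f :
  (forall v, 0 <= f v) -> 0 <= gaussIter mean var rest m f.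
Proof.
elim: m f => [|m ih] f f0 /=; first exact: f0.
by apply: integral_ge0 => x _; apply: ih.
Qed.

Lemma gaussIter_le1 mean var rest m f :
  (forall v, 0 <= f v) -> (forall v, f v <= 1) -> gaussIter mean var rest m f <= 1.
Proof.
elim: m f => [|m ih] f f0 f1 /=; first exact: f1.
by apply: expectation_le1 => x; [apply: gaussIter_ge0|apply: ih].
Qed.

(** A Chernoff bound under the sieve posterior, integrated one coordinate at a time; no product
    measure and no measurability of [f] enter. *)
Lemma gaussIter_ge1B mean var rest m f (c : R) (g : nat -> R -> R) (M : nat -> R) :
  (0 <= c)%R -> (forall v, 0 <= f v) ->
  (forall j, measurable_fun setT (g j)) -> (forall j x, (0 <= g j x)%R) ->
  (forall j, (1 <= j <= m)%N ->
    \int[normal_prob (mean j) (Num.sqrt (var j))]_x (g j x)%:E <= (M j)%:E) ->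
  (forall v, (forall j, (m < j)%N -> v j = rest j) ->
    (1 - c * \prod_(1 <= j < m.+1) g j (v j))%:E <= f v) ->
  (1 - c * \prod_(1 <= j < m.+1) M j)%:E <= gaussIter mean var rest m f.
Proof.
move=> + + mg g0; elim: m f c => [|m ih] f c c0 f0 gM gf /=.
  by have := gf rest (fun _ _ => erefl); rewrite !big_geq.
have M0 j : (1 <= j <= m.+1)%N -> (0 <= M j)%R.
  move=> jm; rewrite -lee_fin; apply: le_trans (gM _ jm).
  by apply: integral_ge0 => x _; rewrite lee_fin.
have pM0 : (0 <= \prod_(1 <= j < m.+1) M j)%R.
  rewrite big_nat_cond prodr_ge0// => j /andP[/andP[j1 jm] _].
  by rewrite M0// j1 ltnW.
have mgE : measurable_fun setT (fun x : R => (g m.+1 x)%:E).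
  by apply/measurable_EFinP; exact: mg.
have mcg : measurable_fun [set: R] (fun x => c * \prod_(1 <= j < m.+1) M j * g m.+1 x)%R.
  by apply: measurable_funM => //; exact: mg.
apply: (@expectation_ge1B _ (measurableTypeR R) R
    (normal_prob (mean m.+1) (Num.sqrt (var m.+1))) _ (fun x => (c * \prod_(1 <= j < m.+1) M j) * g m.+1 x)%R).
- by move=> x; apply: gaussIter_ge0.
- exact: mcg.
- by move=> x; rewrite !mulr_ge0.
(* With the last coordinate frozen at [x], its factor [g m.+1 x] joins the constant; this is why the
   induction is over all [c]. *)
- move=> x; rewrite mulrAC; apply: ih => //.
  + by rewrite mulr_ge0.
  + by move=> j /andP[j1 jm]; apply: gM; rewrite j1 ltnW.
  + move=> v vrest.
    have := gf (upd v m.+1 x).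
    have updE : upd v m.+1 x m.+1 = x by rewrite /upd eqxx.
    rewrite big_nat_recr//= updE.
    have -> : (\prod_(1 <= j < m.+1) g j (upd v m.+1 x j) =
               \prod_(1 <= j < m.+1) g j (v j))%R.
      by apply: eq_big_nat => j /andP[_ jm]; rewrite /upd ltn_eqF.
    rewrite -mulrA [(g _ _ * _)%R]mulrC; apply => j mj.
    by rewrite /upd gtn_eqF// vrest// ltnW.
- under eq_integral do rewrite EFinM.
  rewrite ge0_integralZl//;
    do ?[exact: mgE | by move=> x _; rewrite lee_fin
        | by rewrite lee_fin mulr_ge0].
  rewrite [in leRHS]big_nat_recr//= mulrA [leRHS]EFinM.
  by rewrite lee_wpmul2l ?gM ?leqnn// lee_fin mulr_ge0.
Qed.

End iterated_gaussian_integral.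

(** * Shrinkage weights and the conjugate Gaussian posterior *)

Section one_noise_level.
Context (R : realType).
Variables (lam eta ta : nat -> R) (e : R).
Hypothesis (e0 : 0 < e) (lam0 : forall j, (1 <= j)%N -> lam j != 0).
Hypothesis ta0 : forall j, (1 <= j)%N -> 0 < ta j.

Let sqrte0 : 0 < Num.sqrt e. Proof. by rewrite sqrtr_gt0. Qed.
Let sqrteK : e = Num.sqrt e ^+ 2. Proof. by rewrite sqr_sqrtr// ltW. Qed.

(* The weight of the observation in the posterior mean:
   [thetaY j = shrink j * Y j / lam j + (1 - shrink j) * eta j]. *)
Definition shrink j := sig lam ta e j * lam j ^+ 2 / e.

Lemma lam_sqr_gt0 j : (1 <= j)%N -> 0 < lam j ^+ 2.
Proof. by move=> j1; rewrite exprn_even_gt0// lam0. Qed.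

Lemma Lam_gt0 j : (1 <= j)%N -> 0 < Lam lam j.
Proof. by move=> j1; rewrite invr_gt0 lam_sqr_gt0. Qed.

Let prec0 j : (1 <= j)%N -> 0 < lam j ^+ 2 / e + (ta j)^-1.
Proof. by move=> j1; rewrite addr_gt0 ?divr_gt0 ?invr_gt0 ?lam_sqr_gt0// ta0. Qed.

Lemma sig_gt0 j : (1 <= j)%N -> 0 < sig lam ta e j.
Proof. by move=> j1; rewrite invr_gt0 prec0. Qed.

Lemma sig_le j : (1 <= j)%N -> sig lam ta e j <= e * Lam lam j.
Proof.
move=> j1; rewrite /Lam -[e * _]invrK lef_pV2 ?posrE ?prec0//; last first.
  by rewrite invr_gt0 mulr_gt0 ?invr_gt0 ?lam_sqr_gt0.
by rewrite invfM invrK mulrC lerDl invr_ge0 ltW// ta0.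
Qed.

Let sigM1 j : (1 <= j)%N -> 1 = sig lam ta e j * (lam j ^+ 2 / e + (ta j)^-1).
Proof. by move=> j1; rewrite mulVf// gt_eqF// prec0. Qed.

Lemma onem_shrink j : (1 <= j)%N -> 1 - shrink j = sig lam ta e j / ta j.
Proof.
by move=> j1; rewrite (sigM1 j1) /shrink; ring.
Qed.

Lemma shrink_gt0 j : (1 <= j)%N -> 0 < shrink j.
Proof.
move=> j1; rewrite /shrink; apply: divr_gt0 => //.
by apply: mulr_gt0; [exact: sig_gt0|exact: lam_sqr_gt0].
Qed.

Lemma shrink_le1 j : (1 <= j)%N -> shrink j <= 1.
Proof.
by move=> j1; rewrite -subr_ge0 onem_shrink// ltW// divr_gt0 ?sig_gt0 ?ta0.
Qed.

(** The inverse weight is [1 + e * Lam lam j / ta j]. Thus the data keep a fixed share of the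
    posterior mean, and lost bias stays visible in [normsig]. *)
Lemma shrink_ge d j : 0 < d -> (1 <= j)%N -> d * (e * Lam lam j) <= ta j ->
  (1 + d^-1)^-1 <= shrink j.
Proof.
move=> d0 j1 dt; have l0 := lam_sqr_gt0 j1; have t0 := ta0 j1.
have d1 : 0 < 1 + d^-1 by rewrite addr_gt0 ?invr_gt0.
rewrite -[X in _ <= X]invrK lef_pV2 ?posrE ?invr_gt0 ?shrink_gt0// /shrink /sig.
have -> : ((lam j ^+ 2 / e + (ta j)^-1)^-1 * lam j ^+ 2 / e)^-1 =
    1 + (e * Lam lam j) / ta j.
  rewrite /Lam; field.
  by rewrite lam0// !gt_eqF// addr_gt0// mulr_gt0.
by rewrite lerD2l ler_pdivrMr// -ler_pdivrMl ?invr_gt0// invrK.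
Qed.

(** Here [1 - shrink j] is [sig / ta], with [sig] at most [e * Lam lam j]. The bound keeps the
    squared bias due to the prior of the order of the variance. *)
Lemma onem_shrink_sqr_le d j : 0 < d -> (1 <= j)%N ->
  d * (Num.sqrt e * Num.sqrt (Lam lam j)) <= ta j ->
  (1 - shrink j) ^+ 2 <= e * Lam lam j / d ^+ 2.
Proof.
move=> d0 j1 dt; have t0 := ta0 j1; have L0 := Lam_gt0 j1.
have eL0 : 0 < e * Lam lam j by rewrite mulr_gt0.
have -> : e * Lam lam j / d ^+ 2 = (Num.sqrt (e * Lam lam j) / d) ^+ 2.
  by rewrite expr_div_n sqr_sqrtr// ltW.
have sq0 : 0 < Num.sqrt (e * Lam lam j) by rewrite sqrtr_gt0.
rewrite onem_shrink//; apply: lerXn2r.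
- by rewrite nnegrE ltW// divr_gt0// sig_gt0.
- by rewrite nnegrE ltW// divr_gt0.
rewrite ler_pdivrMr// (le_trans (sig_le j1))// mulrAC ler_pdivlMr//.
rewrite -{1}[e * Lam lam j]sqr_sqrtr; last exact: ltW.
rewrite expr2 -mulrA ler_wpM2l ?(ltW sq0)// mulrC sqrtrM//; exact: ltW.
Qed.

Section data.
Variables (th : nat -> R) (T : Type) (xi : nat -> T -> R) (w : T).
Let Y := dataY lam th e xi w.

Lemma normsig_dataY m :
  normsig lam eta ta e Y m =
  \sum_(1 <= j < m.+1)
    shrink j * (xi j w + lam j * (th j - eta j) / Num.sqrt e) ^+ 2.
Proof.
apply: eq_big_nat => j /andP[j1 jm]; rewrite /thetaHat -ltnS jm /thetaY /shrink.
have t0 := ta0 j1.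
have S0 : sig lam ta e j != 0 by rewrite gt_eqF// sig_gt0.
have -> : sig lam ta e j * ((ta j)^-1 * eta j + lam j * e^-1 * Y j) - eta j =
    sig lam ta e j * (lam j / Num.sqrt e) *
      (xi j w + lam j * (th j - eta j) / Num.sqrt e).
  (* Writing 1 as [sig] times the precision makes [sig] a common factor, and [e] as the square of
     [q] leaves a rational identity. *)
  rewrite -[X in _ - X]mul1r (sigM1 j1) /Y /dataY.
  move: sqrteK sqrte0; generalize (Num.sqrt e) => q -> q0; field.
  by rewrite !gt_eqF.
move: sqrteK sqrte0 S0; generalize (Num.sqrt e) => q.
move: (sig _ _ _ _) => S -> q0 S0; field.
by rewrite S0 gt_eqF.
Qed.

Lemma thetaY_dataY j : (1 <= j)%N ->
  thetaY lam eta ta e Y j - th j =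
  shrink j * Num.sqrt e / lam j * xi j w + (shrink j - 1) * (th j - eta j).
Proof.
move=> j1; have t0 := ta0 j1; have l0 := lam0 j1.
rewrite -(opprB 1 (shrink j)) onem_shrink// /shrink /thetaY.
rewrite -[X in _ - X]mul1r (sigM1 j1) /Y /dataY.
move: sqrteK sqrte0; generalize (Num.sqrt e) => q.
move: (sig _ _ _ _) => S -> q0; field.
by rewrite l0 !gt_eqF.
Qed.

End data.
End one_noise_level.

(** * Exponentials of quadratic forms in the noise *)

Section exponential_moment_products.
Context (R : realType) (dT : measure_display) (T : measurableType dT).
Variables (P : probability T R) (xi : nat -> T -> R).
Hypothesis hxi : iid_std_normal P xi.
Variables (c : R) (p q : nat) (t a b : nat -> R).

(** The common shape of the majorants in all three regimes; the product form lets independence act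
    factor by factor. *)
Definition exp_sqr_prod w :=
  expR c * \prod_(p <= j < q) expR (t j * (a j * xi j w + b j) ^+ 2).

Lemma exp_sqr_prod_ge0 w : 0 <= exp_sqr_prod w.
Proof. by rewrite mulr_ge0 ?expR_ge0// prodr_ge0// => j _; exact: expR_ge0. Qed.

Lemma measurable_exp_sqr_prod : measurable_fun setT exp_sqr_prod.
Proof.
case: hxi => mxi _ _; apply: measurable_funM => //.
apply: measurable_prod => j _.
exact: (measurableT_comp (measurable_expR_sqr (t j) (a j) (b j)) (mxi j)).
Qed.

Lemma expectation_exp_sqr_prod_le (y z : nat -> R) :
  (forall j, (p <= j < q)%N -> [/\ a j != 0, 0 < 1 - 2 * t j * a j ^+ 2,
    (1 - 2 * t j * a j ^+ 2)^-1 <= 1 + 2 * y j &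
    t j * b j ^+ 2 / (1 - 2 * t j * a j ^+ 2) <= z j]) ->
  (\int[P]_w (exp_sqr_prod w)%:E <=
   (expR (c + \sum_(p <= j < q) (y j + z j)))%:E)%E.
Proof.
move=> H; case: (hxi) => mxi _ _.
rewrite /exp_sqr_prod; under eq_integral do rewrite EFinM.
rewrite ge0_integralZl//.
- rewrite expRD expR_sum EFinM lee_wpmul2l ?lee_fin ?expR_ge0//.
  apply: (iid_integral_prod hxi (g := fun j x => expR (t j * (a j * x + b j) ^+ 2))).
  + exact: iota_uniq.
  + by move=> j; exact: measurable_expR_sqr.
  + by move=> j x; exact: expR_ge0.
  + move=> j; rewrite mem_index_iota => /H[? ? ? ?].
    exact: integral_std_normal_exp_sqr_le.
- apply/measurable_EFinP/measurable_prod => j _.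
  exact: (measurableT_comp (measurable_expR_sqr (t j) (a j) (b j)) (mxi j)).
- by move=> w _; rewrite lee_fin prodr_ge0// => j _; exact: expR_ge0.
Qed.

End exponential_moment_products.

(** * Posterior weights of the dimension and the mixture posterior *)

Section posterior_of_the_dimension.
Context (R : realType).
Variables (lam eta ta : nat -> R) (Cl e : R) (Y : nat -> R).
Let G := Gdim lam e.
Let N := normsig lam eta ta e Y.
Let p := postM lam eta ta Cl e Y.
Let wgt k := expR ((N k - 3 * Cl * k%:R) / 2).
Let W := \sum_(1 <= k < G.+1) wgt k.

Let wgt_le_W k : (1 <= k <= G)%N -> wgt k <= W.
Proof.
move=> kG; rewrite /W (bigD1_seq k) ?mem_index_iota ?iota_uniq//=.
by rewrite lerDl sumr_ge0// => i _; exact: expR_ge0.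
Qed.

Let W_ge0 : 0 <= W.
Proof. by rewrite sumr_ge0// => i _; exact: expR_ge0. Qed.

Let W_gt0 : (1 <= G)%N -> 0 < W.
Proof.
by move=> G1; apply: lt_le_trans (expR_gt0 _) (@wgt_le_W 1 _); rewrite G1.
Qed.

Lemma postM_ge0 m : 0 <= p m.
Proof. by rewrite divr_ge0 ?expR_ge0. Qed.

Lemma sum_postM : (1 <= G)%N -> \sum_(1 <= m < G.+1) p m = 1.
Proof. by move=> G1; rewrite -mulr_suml divff// gt_eqF// W_gt0. Qed.

Lemma postM_le1 m : (1 <= m <= G)%N -> p m <= 1.
Proof.
move=> mG; rewrite ler_pdivrMr ?mul1r ?wgt_le_W// W_gt0//.
by case/andP: mG; exact: leq_trans.
Qed.

(** The normalising sum is at least its [k]-th term. *)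
Lemma postM_le_ratio m k : (1 <= k <= G)%N ->
  p m <= expR ((N m - N k - 3 * Cl * (m%:R - k%:R)) / 2).
Proof.
move=> kG; have W0 : 0 < W by apply: W_gt0; case/andP: kG; exact: leq_trans.
rewrite ler_pdivrMr//.
apply: (@le_trans _ _ (expR ((N m - N k - 3 * Cl * (m%:R - k%:R)) / 2) * wgt k)).
  by rewrite -expRD le_eqVlt -/N; apply/orP; left; apply/eqP; congr expR; field.
by rewrite ler_wpM2l ?expR_ge0// wgt_le_W.
Qed.

(** A number bounded by both 1 and a ratio is bounded by the square root of the ratio. *)
Lemma postM_le_sqrt_ratio m k : (1 <= k <= G)%N -> (1 <= m <= G)%N ->
  p m <= expR ((N m - N k - 3 * Cl * (m%:R - k%:R)) / 4).
Proof.
move=> kG mG; set z := (_ - 3 * _ * _).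
have [z0|z0] := leP 0 z.
  by rewrite (le_trans (postM_le1 mG))// -expR0 ler_expR divr_ge0.
by apply: le_trans (postM_le_ratio m kG) _; rewrite ler_expR -/z; lra.
Qed.

Local Open Scope ereal_scope.

Lemma postSieve_ge0 m B : 0 <= postSieve lam eta ta e Y m B.
Proof. by apply: gaussIter_ge0 => v; rewrite lee_fin. Qed.

Lemma postSieve_le1 m B : postSieve lam eta ta e Y m B <= 1.
Proof.
by apply: gaussIter_le1 => v; rewrite lee_fin.
Qed.

Lemma postHier_ge0 B : 0 <= postHier lam eta ta Cl e Y B.
Proof.
by apply: sume_ge0 => m _; rewrite mule_ge0 ?postSieve_ge0// lee_fin postM_ge0.
Qed.

Lemma postHier_le1 B : (1 <= G)%N -> postHier lam eta ta Cl e Y B <= 1.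
Proof.
move=> G1; rewrite -(sum_postM G1) -sumEFin.
apply: lee_sum => m _; rewrite -[leRHS]mule1 lee_wpmul2l ?postSieve_le1//.
by rewrite lee_fin postM_ge0.
Qed.

Lemma postHier_ge1B B (H : nat -> R) : (1 <= G)%N ->
  (forall m, (1 <= m <= G)%N -> exists2 q : R,
    (1 - q)%:E <= postSieve lam eta ta e Y m B & (p m * q <= H m)%R) ->
  (1 - \sum_(1 <= m < G.+1) H m)%:E <= postHier lam eta ta Cl e Y B.
Proof.
move=> G1 hH; rewrite -(sum_postM G1) -sumrB -sumEFin.
rewrite /postHier big_nat_cond [leRHS]big_nat_cond.
apply: lee_sum => m /andP[mG _]; have [q q1 pq] := hH m mG.
apply: (@le_trans _ _ ((p m)%:E * (1 - q)%:E)).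
  by rewrite -EFinM lee_fin mulrBr mulr1 lerB.
by rewrite lee_wpmul2l// lee_fin postM_ge0.
Qed.

End posterior_of_the_dimension.

(** * Expected posterior mass of the ball *)

Section posterior_expectation.
Local Open Scope ereal_scope.
Context (R : realType) (dT : measure_display) (T : measurableType dT).
Variables (P : probability T R) (xi : nat -> T -> R).
Variables (a lam eta : nat -> R) (tau : R -> nat -> R) (Cl : R) (th : nat -> R).
Variables (c e : R).
Hypothesis G1 : (1 <= Gdim lam e)%N.

Lemma postE_le1 : postE P xi a lam eta tau Cl th c e <= 1.
Proof. by apply: expectation_le1 => w; [exact: postHier_ge0|exact: postHier_le1]. Qed.

(** A union bound over the dimensions. The real [q] may depend on the data, so either the weight or
    the sieve posterior can supply the smallness. *)
Lemma postE_ge1B (H : nat -> T -> R) (h : R) :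
  (forall m, (1 <= m <= Gdim lam e)%N ->
    [/\ measurable_fun setT (H m), (forall w, (0 <= H m w)%R),
      \int[P]_w (H m w)%:E <= h%:E &
      forall w, exists2 q : R,
      (1 - q)%:E <= postSieve lam eta (tau e) e (dataY lam th e xi w) m
        [set v : nat -> R | sqnorm (fun j => (v j - th j)%R) <=
                            (c * Phistar a lam e)%:E] &
      (postM lam eta (tau e) Cl e (dataY lam th e xi w) m * q <= H m w)%R]) ->
  (1 - (Gdim lam e)%:R * h)%:E <= postE P xi a lam eta tau Cl th c e.
Proof.
move=> hH; pose H' m w := if (1 <= m <= Gdim lam e)%N then H m w else 0%R.
have H'E m w : (1 <= m <= Gdim lam e)%N -> H' m w = H m w by rewrite /H' => ->.
have mH' m : measurable_fun setT (H' m).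
  by rewrite /H'; case: (boolP (1 <= m <= _)%N) => [/hH[]|].
have H'0 m w : (0 <= H' m w)%R by rewrite /H'; case: ifPn => // /hH[].
apply: (@expectation_ge1B _ _ _ _ _
    (fun w => \sum_(1 <= m < (Gdim lam e).+1) H' m w)%R).
- by move=> w; exact: postHier_ge0.
- exact: measurable_sum.
- by move=> w; rewrite sumr_ge0.
- move=> w; apply: postHier_ge1B => // m mG.
  by have [_ _ _ /(_ w)] := hH m mG; rewrite H'E.
- under eq_integral do rewrite -sumEFin.
  rewrite ge0_integral_sum//; last 2 first.
  + by move=> m; exact/measurable_EFinP.
  + by move=> m w _; rewrite lee_fin.
  have -> : ((Gdim lam e)%:R * h)%R = (\sum_(1 <= m < (Gdim lam e).+1) h)%R.
    by rewrite sumr_const_nat subn1 mulr_natl.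
  rewrite -sumEFin big_nat_cond [leRHS]big_nat_cond.
  apply: lee_sum => m /andP[mG _]; have [_ _ Hh _] := hH m mG.
  by rewrite (eq_integral (fun w => (H m w)%:E))// => w _; rewrite H'E.
Qed.

End posterior_expectation.

(** * Running maxima of the inverse squared eigenvalues *)

Section eigenvalue_maxima.
Context (R : realType) (lam : nat -> R).
Hypothesis lam0 : forall j, (1 <= j)%N -> lam j != 0.

Lemma Lam_le_LamMax j m : (1 <= j <= m)%N -> Lam lam j <= LamMax lam m.
Proof.
by move=> jm; apply: (le_bigmax_seq _ j) => //; rewrite mem_index_iota.
Qed.

Lemma LamMax_gt0 m : (1 <= m)%N -> 0 < LamMax lam m.
Proof.
move=> m1; apply: (lt_le_trans (Lam_gt0 lam0 m1)).
by apply: Lam_le_LamMax; rewrite m1 leqnn.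
Qed.

Lemma LamMax_ge_sqr j m : (1 <= j <= m)%N -> (LamMax lam m)^-1 <= lam j ^+ 2.
Proof.
move=> jm; have /andP[j1 _] := jm.
rewrite -[leRHS]invrK lef_pV2 ?posrE ?Lam_le_LamMax//; last exact: Lam_gt0.
by apply: LamMax_gt0; case/andP: jm; exact: leq_trans.
Qed.

End eigenvalue_maxima.

Lemma exp_sqr_prodE (R : realType) (dT : measure_display) (T : measurableType dT)
    (xi : nat -> T -> R) c p q t a b w :
  exp_sqr_prod xi c p q t a b w =
  expR (c + \sum_(p <= j < q) t j * (a j * xi j w + b j) ^+ 2).
Proof. by rewrite /exp_sqr_prod expRD expR_sum. Qed.

(** * The low, high and middle dimensions at a fixed noise level *)

Section three_regimes.
Context (R : realType) (dT : measure_display) (T : measurableType dT).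
Variables (P : probability T R) (xi : nat -> T -> R).
Hypothesis hxi : iid_std_normal P xi.
Variables (lam eta ta th : nat -> R) (Cl Ll d r e rho kap Ph : R) (ms D : nat).
Hypotheses (e0 : 0 < e) (lam0 : forall j, (1 <= j)%N -> lam j != 0).
Hypothesis ta0 : forall j, (1 <= j)%N -> 0 < ta j.
Hypotheses (d0 : 0 < d) (Cl1 : 1 <= Cl) (Ll1 : 1 <= Ll).
Hypothesis msG : (1 <= ms <= Gdim lam e)%N.
Local Notation shr := (shrink lam ta e).
Local Notation Y w := (dataY lam th e xi w).
Hypothesis shr_ge : forall j, (1 <= j <= Gdim lam e)%N -> (1 + d^-1)^-1 <= shr j.
Hypothesis shr_sqr : forall j, (1 <= j <= Gdim lam e)%N ->
  (1 - shr j) ^+ 2 <= e * Lam lam j / d ^+ 2.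
Hypothesis Ph_ge : e * ms%:R * LamMax lam ms <= Ll * Ph.
Hypothesis Ph_le : kap * Ph <= e * ms%:R * LamMax lam ms.
Hypothesis lam_tail : forall j, (ms < j)%N -> lam j ^+ 2 <= Cl * (LamMax lam ms)^-1.
Hypothesis th_r : forall n, \sum_(1 <= j < n.+1) (th j - eta j) ^+ 2 <= r.
Hypothesis th_tail : forall n, (ms <= n)%N ->
  \sum_(ms.+1 <= j < n.+1) (th j - eta j) ^+ 2 <= rho * Ph.
Hypothesis D2 : (2 <= D)%N.
Hypothesis rho_le : 4 * rho <= kap * (D%:R - 1).

Let beta j := lam j * (th j - eta j) / Num.sqrt e.
(** Threshold for the lost bias, in units of [Ph]: [1 + d^-1] undoes the lower bound on [shr], [Ll]
    passes from [Ph] to the variance, and [8 * Cl * ms] remains. *)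
Let c1 := 8 * Cl * (1 + d^-1) * Ll.

Let ms1 : (1 <= ms)%N. Proof. by case/andP: msG. Qed.
Let LM0 : 0 < LamMax lam ms. Proof. exact: LamMax_gt0. Qed.
Let dd0 : 0 < 1 + d^-1. Proof. by rewrite addr_gt0 ?invr_gt0. Qed.

Let betaE j : beta j ^+ 2 = lam j ^+ 2 / e * (th j - eta j) ^+ 2.
Proof. by rewrite /beta !exprMn exprVn sqr_sqrtr 1?mulrAC// ltW. Qed.

Let normsigB m n w : (m <= n)%N ->
  normsig lam eta ta e (Y w) n - normsig lam eta ta e (Y w) m =
  \sum_(m.+1 <= j < n.+1) shr j * (xi j w + beta j) ^+ 2.
Proof.
move=> mn; rewrite !normsig_dataY//.
by rewrite (@big_cat_nat _ _ _ m.+1 1 n.+1)//= addrAC subrr add0r.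
Qed.

Lemma low_dimension_bound m : (1 <= m < ms)%N ->
  c1 * Ph < \sum_(m.+1 <= j < ms.+1) (th j - eta j) ^+ 2 ->
  let H := exp_sqr_prod xi (3 / 2 * Cl * (ms%:R - m%:R)) m.+1 ms.+1
             (fun j => - (shr j / 2)) (fun=> 1) beta in
  (forall w, postM lam eta ta Cl e (Y w) m <= H w) /\
  (\int[P]_w (H w)%:E <= (expR (- (ms%:R / 8)))%:E)%E.
Proof.
move=> /andP[m1 mms] bm H; split=> [w|].
  apply: le_trans (@postM_le_ratio _ _ _ _ _ _ _ _ _ msG) _.
  rewrite /H exp_sqr_prodE ler_expR -(opprB (normsig _ _ _ _ _ ms)) normsigB; last exact: ltnW.
  rewrite [X in _ <= _ + X](eq_bigr (fun j => - (1 / 2) * (shr j * (xi j w + beta j) ^+ 2))); last first.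
    by move=> j _ /=; ring.
  by rewrite -mulr_sumr; lra.
have j1 j : (m.+1 <= j < ms.+1)%N -> (1 <= j <= ms)%N.
  by move=> /andP[mj jms]; rewrite (leq_trans _ mj).
have jG j : (m.+1 <= j < ms.+1)%N -> (1 <= j <= Gdim lam e)%N.
  by move=> /j1/andP[-> jms]; case/andP: msG => _; exact: leq_trans.
apply: le_trans; first apply: (@expectation_exp_sqr_prod_le _ _ _ _ _ hxi
    _ _ _ _ _ _ (fun=> 0) (fun j => - (shr j * beta j ^+ 2 / 4))).
  move=> j /j1/andP[jj _]; have s0 := shrink_gt0 e0 lam0 ta0 jj.
  have s1 := shrink_le1 e0 lam0 ta0 jj.
  (* The lower bound 1 makes the normalising factor harmless; the upper bound 2 costs half of the
     gain [shr j * beta j ^+ 2 / 2]. *)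
  have k0 : 1 <= 1 - 2 * - (shr j / 2) * 1 ^+ 2 by rewrite expr1n; lra.
  have k2 : 1 - 2 * - (shr j / 2) * 1 ^+ 2 <= 2 by rewrite expr1n; lra.
  have kp : 0 < 1 - 2 * - (shr j / 2) * 1 ^+ 2 := lt_le_trans ltr01 k0.
  split=> //.
    by rewrite mulr0 addr0 invf_le1.
  rewrite ler_pdivrMr// mulNr mulNr lerN2.
  have -> : shr j / 2 * beta j ^+ 2 = (shr j * beta j ^+ 2 / 4) * 2 by field.
  by rewrite ler_wpM2l// divr_ge0// mulr_ge0 ?sqr_ge0// ltW.
rewrite lee_fin ler_expR.
(* A quarter of this sum is gained, so the exponent is at most [(3/2 - 2) * Cl * ms], which suffices
   as [Cl] is at least 1. *)
have sum_ge : 8 * Cl * ms%:R <= \sum_(m.+1 <= j < ms.+1) shr j * beta j ^+ 2.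
  pose x := (1 + d^-1)^-1 * ((LamMax lam ms)^-1 / e).
  have x0 : 0 < x by rewrite mulr_gt0 ?invr_gt0// divr_gt0 ?invr_gt0.
  apply: (@le_trans _ _ (x * (c1 * Ph))).
    have -> : x * (c1 * Ph) = 8 * Cl * ((Ll * Ph) / (e * LamMax lam ms)).
      rewrite /x /c1; field; rewrite !gt_eqF//=.
      by have : 0 < d + 1 by rewrite addr_gt0.
    rewrite ler_wpM2l ?mulr_ge0 ?(le_trans ler01 Cl1)// ler_pdivlMr ?mulr_gt0//.
    by rewrite mulrCA mulrA.
  apply: (@le_trans _ _ (x * \sum_(m.+1 <= j < ms.+1) (th j - eta j) ^+ 2)).
    by rewrite ler_wpM2l ?(ltW x0)// ltW.
  rewrite mulr_sumr big_nat_cond [leRHS]big_nat_cond.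
  apply: ler_sum => j /andP[jm _].
  rewrite betaE mulrA ler_wpM2r ?sqr_ge0//.
  rewrite ler_pM ?invr_ge0 ?(ltW dd0) ?divr_ge0 ?invr_ge0 ?(ltW LM0) ?(ltW e0)//.
    by apply: shr_ge; exact: jG.
  by rewrite ler_wpM2r ?invr_ge0 ?(ltW e0)// LamMax_ge_sqr// j1.
rewrite (eq_bigr (fun j => - (1 / 4) * (shr j * beta j ^+ 2))); last first.
  by move=> j _; rewrite add0r; field.
rewrite -mulr_sumr.
have Cms : ms%:R <= Cl * ms%:R by rewrite -[leLHS]mul1r ler_wpM2r.
have Cm : 0 <= Cl * m%:R by rewrite mulr_ge0// (le_trans ler01 Cl1).
have mms0 : (0 : R) <= ms%:R by [].
move: sum_ge Cms Cm mms0; move: (\sum_(_ <= _ < _) _) => S.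
rewrite mulrBr -!mulrA; move: (Cl * ms%:R) (Cl * m%:R) ms%:R => X X' X''; lra.
Qed.

Lemma high_dimension_bound m : (D * ms < m <= Gdim lam e)%N ->
  let H := exp_sqr_prod xi (- (3 / 4 * Cl * (m%:R - ms%:R))) ms.+1 m.+1
             (fun j => shr j / 4) (fun=> 1) beta in
  (forall w, postM lam eta ta Cl e (Y w) m <= H w) /\
  (\int[P]_w (H w)%:E <= (expR (- (ms%:R / 8)))%:E)%E.
Proof.
move=> /andP[Dm mG] H.
have msm : (ms <= m)%N.
  by apply: leq_trans (ltnW Dm); apply: leq_pmull; exact: ltnW.
split=> [w|].
  apply: le_trans (@postM_le_sqrt_ratio _ _ _ _ _ _ _ _ _ msG _) _.
    by rewrite mG (leq_trans _ msm).
  rewrite /H exp_sqr_prodE ler_expR normsigB//.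
  rewrite [X in _ <= _ + X](eq_bigr (fun j => 1 / 4 * (shr j * (xi j w + beta j) ^+ 2))); last first.
    by move=> j _ /=; ring.
  by rewrite -mulr_sumr; lra.
apply: le_trans; first apply: (@expectation_exp_sqr_prod_le _ _ _ _ _ hxi
    _ _ _ _ _ _ (fun=> 1 / 2) (fun j => beta j ^+ 2 / 2)).
  move=> j /andP[msj _]; have jj : (1 <= j)%N by rewrite (leq_trans _ msj).
  have s0 := shrink_gt0 e0 lam0 ta0 jj.
  have s1 := shrink_le1 e0 lam0 ta0 jj.
  have k0 : 1 / 2 <= 1 - 2 * (shr j / 4) * 1 ^+ 2 by rewrite expr1n; lra.
  have kp : 0 < 1 - 2 * (shr j / 4) * 1 ^+ 2 by apply: lt_le_trans k0; lra.
  have kV : (1 - 2 * (shr j / 4) * 1 ^+ 2)^-1 <= 2.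
    by rewrite invf_ple ?posrE//; move: k0; move: (1 - _) => k; lra.
  split=> //; first by apply: le_trans kV _; lra.
  rewrite ler_pdivrMr//.
  apply: (@le_trans _ _ (beta j ^+ 2 / 2 * (1 / 2))).
    have -> : beta j ^+ 2 / 2 * (1 / 2) = 1 / 4 * beta j ^+ 2 by field.
    by apply: ler_wpM2r; [exact: sqr_ge0|lra].
  by rewrite ler_wpM2l// divr_ge0// sqr_ge0.
rewrite lee_fin ler_expR big_split/= sumr_const_nat subSS -mulr_suml.
(* In units of [Cl * (m - ms)], the penalty gives -3/4, the noise at most 1/2 and half of this sum
   at most 1/8. The total is -1/8, and [Cl * (m - ms)] is at least [ms]. *)
have sum_le : \sum_(ms.+1 <= j < m.+1) beta j ^+ 2 <= Cl * ms%:R * (D%:R - 1) / 4.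
  pose x := Cl / (e * LamMax lam ms).
  have x0 : 0 < x by rewrite divr_gt0 ?mulr_gt0// (lt_le_trans ltr01 Cl1).
  apply: (@le_trans _ _ (x * \sum_(ms.+1 <= j < m.+1) (th j - eta j) ^+ 2)).
    rewrite mulr_sumr big_nat_cond [leRHS]big_nat_cond.
    apply: ler_sum => j /andP[/andP[msj _] _].
    rewrite betaE ler_wpM2r ?sqr_ge0// /x invfM mulrA [leRHS]mulrAC.
    by rewrite ler_wpM2r ?invr_ge0 ?(ltW e0)// lam_tail.
  apply: (@le_trans _ _ (x * (rho * Ph))).
    by rewrite ler_wpM2l ?(ltW x0)// th_tail.
  have rP : rho * Ph <= (D%:R - 1) / 4 * (e * ms%:R * LamMax lam ms).
    apply: (@le_trans _ _ ((D%:R - 1) / 4 * (kap * Ph))).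
      have -> : (D%:R - 1) / 4 * (kap * Ph) = kap * (D%:R - 1) / 4 * Ph by ring.
      apply: ler_wpM2r; last by rewrite ler_pdivlMr// mulrC.
      have eLM : 0 <= e * ms%:R * LamMax lam ms.
        by rewrite !mulr_ge0 ?(ltW e0)// ltW.
      by rewrite -(pmulr_rge0 Ph (lt_le_trans ltr01 Ll1)) (le_trans eLM).
    by rewrite ler_wpM2l// divr_ge0// subr_ge0 ler1n ltnW.
  apply: le_trans (ler_wpM2l (ltW x0) rP) _.
  rewrite /x le_eqVlt; apply/orP; left; apply/eqP; field.
  by rewrite !gt_eqF.
have -> : (1 / 2 : R) *+ (m - ms) = (m%:R - ms%:R) / 2.
  by rewrite -[LHS]mulr_natl natrB//; field.
have mD : D%:R * ms%:R <= m%:R :> R by rewrite -natrM ler_nat ltnW.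
have Cm : m%:R - ms%:R <= Cl * (m%:R - ms%:R).
  by rewrite -[leLHS]mul1r ler_wpM2r// subr_ge0 ler_nat.
have CD : Cl * ((D%:R - 1) * ms%:R) <= Cl * (m%:R - ms%:R).
  by rewrite ler_wpM2l ?(le_trans ler01 Cl1)// mulrBl mul1r lerB.
have D1 : ms%:R <= Cl * ((D%:R - 1) * ms%:R).
  rewrite -[leLHS]mul1r mulrA ler_wpM2r//.
  rewrite -[leLHS]mul1r ler_pM//.
  by rewrite lerBrDr -(natrD _ 1 1) ler_nat.
move: sum_le Cm CD D1.
have -> : Cl * ms%:R * (D%:R - 1) / 4 = Cl * ((D%:R - 1) * ms%:R) / 4 by ring.
rewrite -[3 / 4 * Cl * _]mulrA.
move: (\sum_(_ <= _ < _) _) (Cl * ((D%:R - 1) * ms%:R)) (Cl * (m%:R - ms%:R)) => S X Z.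
by lra.
Qed.

Lemma in_ball_of_partial_sums (v : nat -> R) m X :
  (forall j, (m < j)%N -> v j = eta j) ->
  (forall n, (m <= n)%N -> \sum_(1 <= j < m.+1) (v j - th j) ^+ 2 +
     \sum_(m.+1 <= j < n.+1) (th j - eta j) ^+ 2 <= X) ->
  (sqnorm (fun j => (v j - th j)%R) <= X%:E)%E.
Proof.
move=> vm hX; apply: lime_le.
  by apply: is_cvg_nneseries => n _ _; rewrite lee_fin sqr_ge0.
exists m.+1 => // -[//|n] /= mn; rewrite sumEFin lee_fin.
apply: le_trans (hX n mn); rewrite (@big_cat_nat _ _ _ m.+1 1 n.+1)//=.
rewrite lerD2l le_eqVlt; apply/orP; left; apply/eqP; apply: eq_big_nat => j /andP[mj _].
by rewrite vm// -sqrrN opprB.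
Qed.

(** [V] bounds, up to dimension [D * ms], both the posterior variances and the variances of the
    posterior mean. The Chernoff parameter [t] satisfies [t * V = 1/8], the limit allowed in
    [integral_normal_exp_sqr_le]. *)
Let V := e * LamMax lam (D * ms).
Let t := (8 * V)^-1.
Let V0 : 0 < V.
Proof. by rewrite mulr_gt0// LamMax_gt0// muln_gt0 ms1 andbT ltnW. Qed.
Let t0 : 0 < t. Proof. by rewrite invr_gt0 mulr_gt0. Qed.
Let tV : t * V = 1 / 8.
Proof. by rewrite /t; field; rewrite gt_eqF. Qed.

Variable K : R.
Hypothesis LamMaxM : LamMax lam (D * ms) <= LamMax lam D * LamMax lam ms.
Hypothesis K_ge : 8 * Ll * LamMax lam D * D%:R + c1 + rho <= K.

(** The deterministic coordinates above [m] use up [(c1 + rho) * Ph] of the squared radius; the rest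
    is left to the first [m] coordinates. The two Chernoff steps cost [m / 4] each. *)
Lemma middle_dimension_bound m : (1 <= m <= Gdim lam e)%N -> (m <= D * ms)%N ->
  (forall n, (m <= n)%N ->
    \sum_(m.+1 <= j < n.+1) (th j - eta j) ^+ 2 <= (c1 + rho) * Ph) ->
  let H := exp_sqr_prod xi (m%:R / 4 - t * ((K - c1 - rho) * Ph)) 1 m.+1
             (fun=> 4 / 3 * t) (fun j => shr j * Num.sqrt e / lam j)
             (fun j => (shr j - 1) * (th j - eta j)) in
  (forall w, (1 - H w)%:E <= postSieve lam eta ta e (Y w) m
     [set v : nat -> R | sqnorm (fun j => (v j - th j)%R) <= (K * Ph)%:E])%E /\
  (\int[P]_w (H w)%:E <= (expR (r / (4 * d ^+ 2) - ms%:R / 8))%:E)%E.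
Proof.
move=> mG mD bm H.
have jV j : (1 <= j < m.+1)%N -> e * Lam lam j <= V.
  move=> /andP[j1 jm]; rewrite ler_wpM2l ?(ltW e0)// Lam_le_LamMax// j1.
  exact: leq_trans mD.
split=> [w|].
  have -> : H w = expR (- (t * ((K - c1 - rho) * Ph))) * \prod_(1 <= j < m.+1)
      expR (1 / 4 + 4 / 3 * t * (thetaY lam eta ta e (Y w) j - th j) ^+ 2).
    rewrite /H exp_sqr_prodE -expR_sum -expRD; congr expR.
    rewrite big_split/= sumr_const_nat subSS subn0 -(mulr_natl _ m).
    rewrite (@eq_big_nat _ _ _ _ _ _ (fun j => 4 / 3 * t *
      (thetaY lam eta ta e (Y w) j - th j) ^+ 2)); last first.
      by move=> j /andP[j1 _]; rewrite thetaY_dataY.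
    by ring.
  apply: (gaussIter_ge1B (g := fun j x => expR (t * (x - th j) ^+ 2))).
  - exact: expR_ge0.
  - by move=> v; rewrite lee_fin.
  - move=> j; have := measurable_expR_sqr t 1 (- th j).
    by under eq_fun do rewrite mul1r.
  - by move=> j x; exact: expR_ge0.
  - move=> j /andP[j1 jm]; have s0 := sig_gt0 e0 lam0 ta0 j1.
    apply: integral_normal_exp_sqr_le; [by rewrite sqrtr_gt0|exact: ltW|].
    rewrite sqr_sqrtr ?(ltW s0)// -tV ler_wpM2l ?(ltW t0)//.
    by apply: le_trans (sig_le e0 lam0 ta0 j1) (jV j _); rewrite j1.
  - move=> v vm; rewrite lee_fin indicE.
    (* Either [v] lies in the ball and the indicator is 1, or the exponent is positive and the lower
       bound is negative. *)
    have [vX|vX] := leP (\sum_(1 <= j < m.+1) (v j - th j) ^+ 2) ((K - c1 - rho) * Ph).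
      have vB : (sqnorm (fun j => (v j - th j)%R) <= (K * Ph)%:E)%E.
        apply: (in_ball_of_partial_sums vm) => n mn.
        have := lerD vX (bm n mn); rewrite -mulrDl.
        by have -> : K - c1 - rho + (c1 + rho) = K by ring.
      rewrite mem_set; last exact: vB.
      rewrite /= gerBl mulr_ge0 ?expR_ge0//.
      by apply: prodr_ge0 => j _; exact: expR_ge0.
    have neg : 1 - expR (- (t * ((K - c1 - rho) * Ph))) *
        \prod_(1 <= j < m.+1) expR (t * (v j - th j) ^+ 2) <= 0.
      rewrite subr_le0 -expR_sum -expRD -mulr_sumr -expR0 ler_expR.
      by rewrite addrC subr_ge0; apply: ler_wpM2l; exact: ltW.
    by apply: le_trans neg _; rewrite ler0n.
apply: le_trans; first apply: (@expectation_exp_sqr_prod_le _ _ _ _ _ hxi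
    _ _ _ _ _ _ (fun=> 1 / 4) (fun j => 2 * t * ((shr j - 1) * (th j - eta j)) ^+ 2)).
  move=> j jm; have /andP[j1 _] := jm.
  have s0 := shrink_gt0 e0 lam0 ta0 j1.
  have s1 := shrink_le1 e0 lam0 ta0 j1.
  set u := shr j * Num.sqrt e / lam j.
  have tu : t * u ^+ 2 <= 1 / 8.
    rewrite -tV ler_wpM2l ?(ltW t0)//; apply: le_trans (jV j jm).
    have -> : u ^+ 2 = shr j ^+ 2 * (e * Lam lam j).
      rewrite /u /Lam 2!exprMn sqr_sqrtr; last exact: ltW.
      by rewrite -mulrA; congr (_ * (_ * _)); rewrite exprVn.
    rewrite -[leRHS]mul1r ler_wpM2r ?mulr_ge0 ?(ltW e0) ?(ltW (Lam_gt0 lam0 j1))//.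
    by rewrite expr_le1// ltW.
  (* The posterior step inflated [t] to [4 / 3 * t]; the inverse is still at most 3/2, whence
     another 1/4 per coordinate. *)
  have k0 : 2 / 3 <= 1 - 2 * (4 / 3 * t) * u ^+ 2.
    by rewrite -!mulrA; move: (t * u ^+ 2) tu => z; lra.
  have kp : 0 < 1 - 2 * (4 / 3 * t) * u ^+ 2 by apply: lt_le_trans k0; lra.
  split=> //.
  + apply: mulf_neq0; last by rewrite invr_neq0 ?lam0.
    by apply: mulf_neq0; apply: lt0r_neq0; rewrite ?sqrtr_gt0.
  + apply: (@le_trans _ _ (3 / 2)); last by lra.
    rewrite invf_ple ?posrE// ?divr_gt0// (_ : (3 / 2)^-1 = 2 / 3)//.
    by rewrite invf_div.
  + rewrite ler_pdivrMr//; set z := _ ^+ 2.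
    have z0 : 0 <= t * z by rewrite mulr_ge0 ?(ltW t0)// sqr_ge0.
    apply: (@le_trans _ _ (2 * t * z * (2 / 3))).
      by have -> : 2 * t * z * (2 / 3) = 4 / 3 * t * z by field.
    by rewrite ler_wpM2l// -mulrA mulr_ge0.
rewrite lee_fin ler_expR big_split/= sumr_const_nat subSS subn0 -mulr_sumr.
have sum_le : \sum_(1 <= j < m.+1) ((shr j - 1) * (th j - eta j)) ^+ 2 <=
    V / d ^+ 2 * r.
  apply: (@le_trans _ _ (V / d ^+ 2 * \sum_(1 <= j < m.+1) (th j - eta j) ^+ 2)).
    rewrite mulr_sumr big_nat_cond [leRHS]big_nat_cond.
    apply: ler_sum => j /andP[jm _]; rewrite exprMn ler_wpM2r ?sqr_ge0//.
    rewrite -sqrrN opprB; apply: (@le_trans _ _ (e * Lam lam j / d ^+ 2)).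
      apply: shr_sqr; case/andP: jm => -> /= jm; case/andP: mG => _.
      exact: leq_trans.
    by rewrite ler_wpM2r ?invr_ge0 ?sqr_ge0// jV.
  by rewrite ler_wpM2l// divr_ge0 ?sqr_ge0// ltW.
have tsum : 2 * t * \sum_(1 <= j < m.+1) ((shr j - 1) * (th j - eta j)) ^+ 2 <=
    r / (4 * d ^+ 2).
  apply: (@le_trans _ _ (2 * t * (V / d ^+ 2 * r))).
    by rewrite ler_wpM2l// mulr_ge0// ltW.
  rewrite (_ : 2 * t * (V / d ^+ 2 * r) = 2 * (t * V) * (r / d ^+ 2)); last by ring.
  rewrite tV le_eqVlt; apply/orP; left; apply/eqP; field.
  by rewrite gt_eqF.
have Ph0 : 0 <= Ph.
  have eLM : 0 <= e * ms%:R * LamMax lam ms by rewrite !mulr_ge0 ?(ltW e0)// ltW.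
  by rewrite -(pmulr_rge0 Ph (lt_le_trans ltr01 Ll1)) (le_trans eLM).
have LD0 : 0 < LamMax lam D by rewrite LamMax_gt0// ltnW.
(* The leading term of [K] is made for this: its 8 cancels the one in [t], and [LamMax lam D] comes
   from submultiplicativity. Since [m] is at most [D * ms], the cost [m / 2] uses up at most half of
   it. *)
have tT : D%:R * ms%:R <= t * ((K - c1 - rho) * Ph).
  apply: (@le_trans _ _ (t * (8 * Ll * LamMax lam D * D%:R * Ph))); last first.
    rewrite ler_wpM2l ?(ltW t0)// ler_wpM2r//; move: K_ge.
    by move: (8 * Ll * LamMax lam D * D%:R) => z; lra.
  have -> : t * (8 * Ll * LamMax lam D * D%:R * Ph) =
      8 * t * D%:R * (LamMax lam D * (Ll * Ph)) by ring.
  apply: (@le_trans _ _ (8 * t * D%:R * (V * ms%:R))).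
    rewrite (_ : 8 * t * D%:R * (V * ms%:R) = 8 * (t * V) * (D%:R * ms%:R)); last by ring.
    by rewrite tV; lra.
  rewrite ler_wpM2l ?mulr_ge0 ?(ltW t0)//.
  apply: (@le_trans _ _ (LamMax lam D * (e * ms%:R * LamMax lam ms))); last first.
    by rewrite ler_wpM2l// ltW.
  rewrite (_ : LamMax lam D * (e * ms%:R * LamMax lam ms) =
               e * (LamMax lam D * LamMax lam ms) * ms%:R); last by ring.
  by rewrite ler_wpM2r// ler_wpM2l// ltW.
have mDR : m%:R <= D%:R * ms%:R :> R by rewrite -natrM ler_nat.
have msD : ms%:R <= D%:R * ms%:R :> R.
  by rewrite -natrM ler_nat leq_pmull// ltnW.
rewrite -(mulr_natl _ m).
move: tsum tT mDR msD; move: (2 * t * _) (t * _) (r / _) (D%:R * ms%:R) => A1 A2 A3 A4.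
have : (0 : R) <= ms%:R by [].
by lra.
Qed.

End three_regimes.

(** * Assembling the three regimes *)

Section concentration_at_one_noise_level.
Context (R : realType) (dT : measure_display) (T : measurableType dT).
Variables (P : probability T R) (xi : nat -> T -> R).
Hypothesis hxi : iid_std_normal P xi.
Variables (a lam eta : nat -> R) (tau : R -> nat -> R) (th : nat -> R).
Variables (Cl Ll d r e rho kap K : R) (D : nat).
Let ms := mstar a lam e.
Let Ph := Phistar a lam e.
Local Notation G := (Gdim lam e).

Lemma postE_lower_bound :
  0 < e -> (forall j, (1 <= j)%N -> lam j != 0) ->
  (forall j, (1 <= j)%N -> 0 < tau e j) ->
  0 < d -> 1 <= Cl -> 1 <= Ll -> (1 <= ms <= G)%N ->
  (forall j, (1 <= j <= G)%N ->
    d * Num.max (Num.sqrt e * Num.sqrt (Lam lam j)) (e * Lam lam j) <= tau e j) ->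
  e * ms%:R * LamMax lam ms <= Ll * Ph ->
  kap * Ph <= e * ms%:R * LamMax lam ms ->
  (forall j, (ms < j)%N -> lam j ^+ 2 <= Cl * (LamMax lam ms)^-1) ->
  (forall n, \sum_(1 <= j < n.+1) (th j - eta j) ^+ 2 <= r) ->
  (forall n, (ms <= n)%N ->
    \sum_(ms.+1 <= j < n.+1) (th j - eta j) ^+ 2 <= rho * Ph) ->
  0 <= rho -> (2 <= D)%N -> 4 * rho <= kap * (D%:R - 1) ->
  LamMax lam (D * ms) <= LamMax lam D * LamMax lam ms ->
  8 * Ll * LamMax lam D * D%:R + 8 * Cl * (1 + d^-1) * Ll + rho <= K ->
  ((1 - G%:R * expR (r / (4 * d ^+ 2) - ms%:R / 8))%:E <=
   postE P xi a lam eta tau Cl th K e)%E.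
Proof.
move=> e0 lam0 ta0 d0 Cl1 Ll1 msG hA Ph_ge Ph_le lam_tail th_r th_tail rho0
  D2 rho_le LamMaxM K_ge.
have /andP[ms1 msG'] := msG.
have G1 : (1 <= G)%N by exact: leq_trans msG'.
have shr_ge j : (1 <= j <= G)%N -> (1 + d^-1)^-1 <= shrink lam (tau e) e j.
  move=> jG; have /andP[j1 _] := jG; apply: shrink_ge => //.
  by apply: le_trans (hA j jG); rewrite ler_wpM2l ?(ltW d0)// le_max lexx orbT.
have shr_sqr j : (1 <= j <= G)%N ->
    (1 - shrink lam (tau e) e j) ^+ 2 <= e * Lam lam j / d ^+ 2.
  move=> jG; have /andP[j1 _] := jG; apply: onem_shrink_sqr_le => //.
  by apply: le_trans (hA j jG); rewrite ler_wpM2l ?(ltW d0)// le_max lexx.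
have Ph0 : 0 <= Ph.
  have eLM : 0 <= e * ms%:R * LamMax lam ms.
    by rewrite !mulr_ge0 ?(ltW e0)// ltW// LamMax_gt0.
  by rewrite -(pmulr_rge0 Ph (lt_le_trans ltr01 Ll1)) (le_trans eLM).
have r0 : 0 <= r.
  by apply: le_trans (th_r 0%N); rewrite big_geq.
pose A := r / (4 * d ^+ 2).
have A0 : 0 <= A by rewrite divr_ge0// mulr_ge0// sqr_ge0.
have exp_le : expR (- (ms%:R / 8)) <= expR (A - ms%:R / 8).
  by rewrite ler_expR lerDr.
pose c1 := 8 * Cl * (1 + d^-1) * Ll.
have c10 : 0 <= c1.
  rewrite /c1 !mulr_ge0 ?(le_trans ler01 Cl1) ?(le_trans ler01 Ll1)//.
  by rewrite addr_ge0// invr_ge0 ltW.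
have sq0 p q : 0 <= \sum_(p <= j < q) (th j - eta j) ^+ 2.
  by rewrite sumr_ge0// => j _; exact: sqr_ge0.
have split_sum p q n : (p <= q)%N -> (q <= n)%N ->
    \sum_(p.+1 <= j < n.+1) (th j - eta j) ^+ 2 =
    \sum_(p.+1 <= j < q.+1) (th j - eta j) ^+ 2 +
    \sum_(q.+1 <= j < n.+1) (th j - eta j) ^+ 2.
  by move=> pq qn; rewrite (@big_cat_nat _ _ _ q.+1).
(* When the weight of the dimension is itself small, [q] is 1 and nothing is asked of the sieve
   posterior. *)
have out m (H : T -> R) :
    (1 <= m <= G)%N -> measurable_fun setT H -> (forall w, 0 <= H w) ->
    (forall w, postM lam eta (tau e) Cl e (dataY lam th e xi w) m <= H w) ->
    (\int[P]_w (H w)%:E <= (expR (- (ms%:R / 8)))%:E)%E ->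
  [/\ measurable_fun setT H, (forall w, 0 <= H w),
      (\int[P]_w (H w)%:E <= (expR (A - ms%:R / 8))%:E)%E &
      forall w, exists2 q : R,
      ((1 - q)%:E <= postSieve lam eta (tau e) e (dataY lam th e xi w) m
        [set v : nat -> R | (sqnorm (fun j => (v j - th j)%R) <=
                            (K * Phistar a lam e)%:E)%E])%E &
      postM lam eta (tau e) Cl e (dataY lam th e xi w) m * q <= H w].
  move=> mG mH H0 pH IH; split=> //; first by apply: le_trans IH _; rewrite lee_fin.
  move=> w; exists 1; last by rewrite mulr1.
  by rewrite subrr; exact: postSieve_ge0.
suff H m : exists H : T -> R, (1 <= m <= G)%N ->
  [/\ measurable_fun setT H, (forall w, 0 <= H w),
      (\int[P]_w (H w)%:E <= (expR (A - ms%:R / 8))%:E)%E &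
      forall w, exists2 q : R,
      ((1 - q)%:E <= postSieve lam eta (tau e) e (dataY lam th e xi w) m
        [set v : nat -> R | (sqnorm (fun j => (v j - th j)%R) <=
                            (K * Phistar a lam e)%:E)%E])%E &
      postM lam eta (tau e) Cl e (dataY lam th e xi w) m * q <= H w].
  have [F HF] := choice H.
  exact: (postE_ge1B G1 HF).
have [mG|mG] := boolP (1 <= m <= G)%N; last by exists (fun=> 0).
have /andP[m1 mG'] := mG.
have [Dm|Dm] := ltnP (D * ms) m.
  have [|HP HI] := high_dimension_bound hxi e0 lam0 ta0 Cl1 Ll1 msG
    Ph_ge Ph_le lam_tail th_tail D2 rho_le (m := m).
  - by rewrite Dm.
  - eexists => _; apply: out HP HI => //; first exact: (measurable_exp_sqr_prod hxi).
    by move=> w; exact: exp_sqr_prod_ge0.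
(* If this fails, the bias beyond [m] is at most [c1 * Ph] up to [ms] plus [rho * Ph] after it, as
   the middle regime requires. *)
have [/andP[mms lo]|/nandP nlo] := boolP ((m < ms)%N &&
    (c1 * Ph < \sum_(m.+1 <= j < ms.+1) (th j - eta j) ^+ 2)).
  have mms' : (1 <= m < ms)%N by rewrite m1.
  have [HP HI] := low_dimension_bound hxi e0 lam0 ta0 d0 Cl1 msG shr_ge Ph_ge mms' lo.
  eexists => _; apply: out HP HI => //; first exact: (measurable_exp_sqr_prod hxi).
  by move=> w; exact: exp_sqr_prod_ge0.
have tail n : (m <= n)%N ->
    \sum_(m.+1 <= j < n.+1) (th j - eta j) ^+ 2 <= (c1 + rho) * Ph.
  move=> mn; rewrite mulrDl.
  have [msm|mms] := leqP ms m.
    apply: le_trans (_ : rho * Ph <= _); last by rewrite lerDr mulr_ge0.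
    apply: le_trans (th_tail n (leq_trans msm mn)).
    by rewrite (split_sum _ _ _ msm mn) lerDr.
  have lo : \sum_(m.+1 <= j < ms.+1) (th j - eta j) ^+ 2 <= c1 * Ph.
    by case: nlo; rewrite ?mms// -leNgt.
  have [msn|nms] := leqP ms n.
    by rewrite (split_sum _ _ _ (ltnW mms) msn) lerD// th_tail.
  apply: le_trans (_ : c1 * Ph <= _); last by rewrite lerDl mulr_ge0.
  by apply: le_trans lo; rewrite (split_sum _ _ _ mn (ltnW nms)) lerDl.
have [HP HI] := middle_dimension_bound hxi e0 lam0 ta0 d0 Ll1 msG shr_sqr
  Ph_ge th_r D2 LamMaxM K_ge mG Dm tail.
eexists => _; split; last first.
- move=> w; eexists; first exact: HP.
  by apply: ler_piMl; [exact: exp_sqr_prod_ge0|exact: postM_le1].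
- exact: HI.
- by move=> w; exact: exp_sqr_prod_ge0.
- exact: (measurable_exp_sqr_prod hxi).
Qed.

End concentration_at_one_noise_level.

(** * Limits as the noise level tends to 0 *)

Lemma cvge_to_1 (R : realType) (F : set_system R) (FF : Filter F) (f : R -> \bar R) :
  (forall x : R, 0 < x -> \forall e \near F, ((1 - x)%:E <= f e /\ f e <= 1)%E) ->
  f e @[e --> F] --> 1%E.
Proof.
move=> H; apply/fine_cvgP; split.
  near=> e; have [f0 f1] : ((1 - 1)%:E <= f e /\ f e <= 1)%E by near: e; exact: H.
  by rewrite ge0_fin_numE; [rewrite (le_lt_trans f1)// ltry|rewrite subrr in f0].
apply/cvgrPdist_le => x x0; near=> e.
have [f0 f1] : ((1 - x)%:E <= f e /\ f e <= 1)%E by near: e; exact: H.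
have ff : f e \is a fin_num.
  rewrite fin_numE; apply/andP; split; apply/eqP => fe; move: f0 f1; rewrite fe//.
move: f0 f1; rewrite /= -(fineK ff) !lee_fin => f0 f1.
by rewrite ger0_norm ?subr_ge0// lerBlDr addrC -lerBlDr.
Unshelve. all: by end_near. Qed.

Section asymptotics.
Context (R : realType) (a lam : nat -> R) (eo Ll : R).
Hypothesis lam0 : forall j, (1 <= j)%N -> lam j != 0.
Hypothesis a_gt0 : forall j, (1 <= j)%N -> 0 < a j.
Hypothesis a_mono : forall i j, (1 <= i <= j)%N -> a j <= a i.
Hypothesis a_cvg0 : a n @[n --> \oo] --> 0.
Hypothesis eo01 : 0 < eo < 1.
Hypothesis Ll1 : 1 <= Ll.
Hypothesis LamMaxM : forall k l, (1 <= k)%N -> (1 <= l)%N ->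
  LamMax lam (k * l) <= LamMax lam k * LamMax lam l.
Hypothesis LamMax_LamBar : forall k, (1 <= k)%N -> LamMax lam k / LamBar lam k <= Ll.

Let Ll0 : 0 < Ll. Proof. exact: lt_le_trans Ll1. Qed.

Lemma LamBar_gt0 k : (1 <= k)%N -> 0 < LamBar lam k.
Proof.
move=> k1; rewrite divr_gt0 ?ltr0n//.
rewrite big_ltn// ltr_pwDl ?Lam_gt0//.
rewrite big_nat_cond sumr_ge0// => j /andP[/andP[j1 _] _].
by rewrite ltW// Lam_gt0// ltnW.
Qed.

Lemma LamBar_le_LamMax k : (1 <= k)%N -> LamBar lam k <= LamMax lam k.
Proof.
move=> k1; rewrite ler_pdivrMr ?ltr0n//.
have -> : LamMax lam k * k%:R = \sum_(1 <= j < k.+1) LamMax lam k.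
  by rewrite sumr_const_nat subn1 mulr_natr.
rewrite big_nat_cond [leRHS]big_nat_cond; apply: ler_sum => j /andP[jk _].
exact: Lam_le_LamMax.
Qed.

Lemma LamMax_le_LamBar k : (1 <= k)%N -> LamMax lam k <= Ll * LamBar lam k.
Proof. by move=> k1; rewrite -ler_pdivrMr ?LamBar_gt0// LamMax_LamBar. Qed.

Lemma LamMax1 : LamMax lam 1 = Lam lam 1.
Proof.
rewrite /LamMax big_ltn// big_geq//; apply/max_idPl.
by rewrite ltW// Lam_gt0.
Qed.

(** Submultiplicativity at [k = l = 1] says that [Lam lam 1] is at most its square. *)
Lemma LamMax_ge1 k : (1 <= k)%N -> 1 <= LamMax lam k.
Proof.
move=> k1; apply: le_trans (_ : Lam lam 1 <= _); last exact: Lam_le_LamMax.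
have L0 : 0 < Lam lam 1 by exact: Lam_gt0.
by have := LamMaxM (leqnn 1) (leqnn 1); rewrite LamMax1 ler_pMl.
Qed.

Lemma crit_ge e k : 0 < e -> (1 <= k)%N -> e * k%:R / Ll <= crit a lam e k.
Proof.
move=> e0 k1; rewrite /crit le_max; apply/orP; right.
rewrite ler_wpM2l ?mulr_ge0 ?(ltW e0)// -[leLHS]mul1r ler_pdivrMr// mulrC.
exact: le_trans (LamMax_ge1 k1) (LamMax_le_LamBar k1).
Qed.

(** As [mstar] is an [xget] with default 0, a minimiser must be shown to exist. By [crit_ge] the
    criterion grows at least linearly, so beyond [N] it exceeds its value at 1 and a finite search
    suffices. *)
Lemma mstar_spec e : 0 < e ->
  (1 <= mstar a lam e)%N /\
  forall k, (1 <= k)%N -> Phistar a lam e <= crit a lam e k.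
Proof.
move=> e0.
pose c := crit a lam e 1; pose N := Num.truncn (c * Ll / e).
have farN k : (N < k)%N -> c <= crit a lam e k.
  move=> Nk; apply: le_trans (crit_ge e0 _); last exact: leq_trans Nk.
  rewrite ler_pdivlMr// mulrC -ler_pdivrMl//.
  rewrite (_ : e^-1 * (Ll * c) = c * Ll / e); last by ring.
  by apply: ltW; apply: lt_le_trans (truncnS_gt _) _; rewrite ler_nat.
have [m m1 hm] : exists2 m, (1 <= m)%N &
    forall k, (1 <= k)%N -> crit a lam e m <= crit a lam e k.
  have P1 : (1 <= (inord 1 : 'I_N.+2))%N by rewrite inordK.
  have [i i1 hi] := arg_minP (fun i : 'I_N.+2 => crit a lam e i)
    (P1 : (fun i : 'I_N.+2 => (1 <= i)%N) (inord 1)).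
  exists i => // k k1; have [kN|Nk] := ltnP k N.+2.
    exact: (hi (Ordinal kN)).
  apply: le_trans (hi (inord 1) P1) _; rewrite inordK//.
  by apply: farN; exact: ltnW.
have exQ : exists m, `[< (1 <= m)%N /\
    forall k, (1 <= k)%N -> crit a lam e m <= crit a lam e k >].
  by exists m; apply/asboolP.
case: (ex_minnP exQ) => m' /asboolP[m'1 hm'] m'min.
have [] : is_mstar a lam e (mstar a lam e); last by move=> ? ? _; split.
apply: xgetPex; exists m'; split => // k k1 hk.
by apply: m'min; apply/asboolP.
Qed.

Lemma Phistar_ge_a e : a (mstar a lam e) <= Phistar a lam e.
Proof. by rewrite /Phistar /crit le_max lexx. Qed.

Lemma Phistar_gt0 e : 0 < e -> 0 < Phistar a lam e.
Proof.
by move=> /mstar_spec[ms1 _]; apply: lt_le_trans (Phistar_ge_a e); exact: a_gt0.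
Qed.

Lemma Phistar_ge_var e : 0 < e ->
  e * (mstar a lam e)%:R * LamMax lam (mstar a lam e) <= Ll * Phistar a lam e.
Proof.
move=> e0; have [ms1 _] := mstar_spec e0; have mR : 0 <= e * (mstar a lam e)%:R.
  by rewrite mulr_ge0// ltW.
apply: le_trans (ler_wpM2l mR (LamMax_le_LamBar ms1)) _.
by rewrite mulrCA ler_wpM2l ?(ltW Ll0)// /Phistar /crit le_max lexx orbT.
Qed.

Let ratio e := (Phistar a lam e)^-1 *
  Num.min (a (mstar a lam e)) (e * (mstar a lam e)%:R * LamBar lam (mstar a lam e)).

Let kappastar_le_ratio e : 0 < e < eo -> kappastar a lam eo <= ratio e.
Proof.
move=> eeo; apply: ge_inf; last by exists e.
exists 0 => _ [x /andP[x0 _] <-]; have [ms1 _] := mstar_spec x0.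
rewrite mulr_ge0 ?invr_ge0 ?(ltW (Phistar_gt0 x0))// le_min.
rewrite (ltW (a_gt0 ms1)) /=; apply: mulr_ge0; last exact/ltW/LamBar_gt0.
by rewrite mulr_ge0// ltW.
Qed.

Lemma kappastar_le e : 0 < e < eo -> kappastar a lam eo * Phistar a lam e <=
  e * (mstar a lam e)%:R * LamMax lam (mstar a lam e).
Proof.
move=> eeo; have /andP[e0 _] := eeo; have [ms1 _] := mstar_spec e0.
rewrite -ler_pdivlMr ?Phistar_gt0//; apply: le_trans (kappastar_le_ratio eeo) _.
rewrite /ratio mulrC ler_wpM2r ?invr_ge0 ?(ltW (Phistar_gt0 e0))//.
rewrite ge_min; apply/orP; right.
by rewrite ler_wpM2l ?LamBar_le_LamMax// mulr_ge0// ltW.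
Qed.

(** Any noise level below [eo] shows it. This is what forces [Dstar] to be at least 5. *)
Lemma kappastar_le1 : kappastar a lam eo <= 1.
Proof.
have /andP[eo0 _] := eo01.
have e20 : 0 < eo / 2 by rewrite divr_gt0.
apply: le_trans (kappastar_le_ratio (e := eo / 2) _) _.
  by rewrite e20/= ltr_pdivrMr// ltr_pMr// ltr1n.
rewrite /ratio mulrC ler_pdivrMr ?Phistar_gt0// mul1r.
by apply: le_trans _ (Phistar_ge_a _); rewrite ge_min lexx.
Qed.

(** A fixed dimension with small [a] is a competitor, and its variance term vanishes with [e]. *)
Lemma Phistar_near0 x : 0 < x -> \forall e \near (0 : R)^'+, Phistar a lam e <= x.
Proof.
move=> x0.
have /cvgrPdist_le /(_ x x0) [N _ hN] := a_cvg0.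
have L0 : 0 < N.+1%:R * LamBar lam N.+1 by rewrite mulr_gt0// LamBar_gt0.
near=> e.
have e0 : 0 < e by near: e; exact: nbhs_right_gt.
have e1 : e < x / (N.+1%:R * LamBar lam N.+1).
  by near: e; apply: nbhs_right_lt; rewrite divr_gt0.
have [_ hmin] := mstar_spec e0.
apply: le_trans (hmin N.+1 isT) _; rewrite /crit ge_max; apply/andP; split.
  apply: le_trans (ler_norm _) _; rewrite -normrN -[- _]add0r.
  by apply: (hN N.+1 _); exact: leqnSn.
by rewrite -mulrA -ler_pdivlMr// ltW.
Unshelve. all: by end_near. Qed.

(** A bounded [mstar] would keep [Phistar] above a fixed positive value of [a]. *)
Lemma mstar_near_oo N : \forall e \near (0 : R)^'+, (N <= mstar a lam e)%N.
Proof.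
have aN : 0 < a N.+1 by exact: a_gt0.
near=> e.
have e0 : 0 < e by near: e; exact: nbhs_right_gt.
have Phe : Phistar a lam e <= a N.+1 / 2.
  by near: e; apply: Phistar_near0; rewrite divr_gt0.
have [ms1 _] := mstar_spec e0.
rewrite leqNgt; apply/negP => msN.
have msN' : (1 <= mstar a lam e <= N.+1)%N by rewrite ms1 ltnW// ltnW.
have := le_trans (a_mono msN') (le_trans (Phistar_ge_a e) Phe).
by rewrite leNgt ltr_pdivrMr// ltr_pMr// ltr1n.
Unshelve. all: by end_near. Qed.

(** Once [e * ms * LamMax lam ms] is below both 1 and [Lam lam 1], dropping the factor
    [LamMax lam ms] or [ms], each at least 1, gives the two conditions defining [Gdim]. *)
Lemma mstar_near_le_Gdim : \forall e \near (0 : R)^'+,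
  (1 <= mstar a lam e <= Gdim lam e)%N.
Proof.
have L10 : 0 < Lam lam 1 by exact: Lam_gt0.
pose x := Num.min 1 (Lam lam 1) / Ll.
have x0 : 0 < x by rewrite divr_gt0// lt_min ltr01.
near=> e.
have e0 : 0 < e by near: e; exact: nbhs_right_gt.
have Phe : Phistar a lam e <= x by near: e; exact: Phistar_near0.
have [ms1 _] := mstar_spec e0; rewrite ms1/=.
set ms := mstar a lam e in ms1 *.
have var : e * ms%:R * LamMax lam ms <= Num.min 1 (Lam lam 1).
  apply: le_trans (Phistar_ge_var e0) _.
  by rewrite mulrC -ler_pdivlMr.
have LM1 : 1 <= LamMax lam ms by exact: LamMax_ge1.
have msR : (1 : R) <= ms%:R by rewrite ler1n.
move: var; rewrite le_min => /andP[var1 varL].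
apply: (@leq_bigmax_seq _ _ _ (fun m => m)).
  rewrite mem_index_iota ms1 ltnS truncn_ge_nat ?invr_ge0 ?(ltW e0)//.
  rewrite -[leRHS]mul1r ler_pdivlMr// mulrC.
  apply: le_trans var1; rewrite mulrC -[leLHS]mulr1.
  by apply: ler_wpM2l LM1; rewrite mulr_ge0// ltW.
apply: le_trans varL; rewrite -mulrA ler_wpM2l ?(ltW e0)//.
by rewrite -[leLHS]mul1r ler_wpM2r// (le_trans ler01).
Unshelve. all: by end_near. Qed.

(** Half of the exponent [mstar / 8] pays for [ln G], the other half for [A - ln x]. *)
Lemma dimension_error_near0 (A x : R) : 0 < x ->
  ln ((Gdim lam e)%:R : R) / (mstar a lam e)%:R @[e --> (0:R)^'+] --> (0:R) ->
  \forall e \near (0 : R)^'+,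
    (Gdim lam e)%:R * expR (A - (mstar a lam e)%:R / 8) <= x.
Proof.
move=> x0 /cvgrPdist_le /(_ (1 / 16)) hlog.
pose N := (Num.truncn (16 * (A - ln x))).+1.
near=> e.
have /andP[ms1 msG] : (1 <= mstar a lam e <= Gdim lam e)%N.
  by near: e; exact: mstar_near_le_Gdim.
have msN : (N <= mstar a lam e)%N by near: e; exact: mstar_near_oo.
have G0 : (0 : R) < (Gdim lam e)%:R by rewrite ltr0n (leq_trans _ msG).
have msR : (0 : R) < (mstar a lam e)%:R by rewrite ltr0n.
have lnG : ln ((Gdim lam e)%:R : R) <= (mstar a lam e)%:R / 16.
  rewrite mulrC -ler_pdivrMr// -[16^-1]mul1r.
  apply: le_trans (ler_norm _) _; rewrite -normrN -[- _]add0r.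
  by near: e; apply: hlog.
have msN' : 16 * (A - ln x) <= (mstar a lam e)%:R.
  by apply: ltW; apply: lt_le_trans (truncnS_gt _) _; rewrite ler_nat.
rewrite -[X in X * _]lnK ?posrE// -[leRHS]lnK ?posrE// -expRD ler_expR.
by lra.
Unshelve. all: by end_near. Qed.

(** * Concentration uniformly over parameters with a common tail bound *)

Section concentration.
Variables (eta : nat -> R) (tau : R -> nat -> R) (d Cl r : R).
Hypothesis htau : forall (e : R) j, 0 < e < 1 -> (1 <= j)%N -> 0 < tau e j.
Hypothesis d0 : 0 < d.
Hypothesis hA : forall (e : R) j, 0 < e < 1 -> (1 <= j <= Gdim lam e)%N ->
  d * Num.max (Num.sqrt e * Num.sqrt (Lam lam j)) (e * Lam lam j) <= tau e j.
Hypothesis Cl1 : 1 <= Cl.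
Hypothesis hEi : forall k, (1 <= k)%N -> forall j, (k < j)%N ->
  lam j ^+ 2 <= Cl * (LamMax lam k)^-1.
Hypothesis hlog :
  ln ((Gdim lam e)%:R : R) / (mstar a lam e)%:R @[e --> (0:R)^'+] --> (0:R).
Variables (dT : measure_display) (T : measurableType dT) (P : probability T R).
Variables (xi : nat -> T -> R).
Hypothesis hxi : iid_std_normal P xi.

(** The quantifiers over [th] and [K] stand inside the neighbourhood: only [rho], [D], [N0] and [x]
    decide how small [e] must be, which yields the pointwise and the uniform assertion alike. *)
Lemma postE_near1 (rho : R) (D N0 : nat) (x : R) : 0 < x ->
  0 <= rho -> (2 <= D)%N -> 4 * rho <= kappastar a lam eo * (D%:R - 1) ->
  \forall e \near (0 : R)^'+, forall (th : nat -> R) (K : R),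
    (forall n, \sum_(1 <= j < n.+1) (th j - eta j) ^+ 2 <= r) ->
    (forall m n, (1 <= m)%N -> (N0 <= m <= n)%N ->
      \sum_(m.+1 <= j < n.+1) (th j - eta j) ^+ 2 <= rho * a m) ->
    8 * Ll * LamMax lam D * D%:R + 8 * Cl * (1 + d^-1) * Ll + rho <= K ->
    ((1 - x)%:E <= postE P xi a lam eta tau Cl th K e /\
     postE P xi a lam eta tau Cl th K e <= 1)%E.
Proof.
move=> x0 rho0 D2 rho_le.
have /andP[eo0 eo1] := eo01.
near=> e.
have e0 : 0 < e by near: e; exact: nbhs_right_gt.
have eeo : e < eo by near: e; exact: nbhs_right_lt.
have e01 : 0 < e < 1 by rewrite e0 (lt_trans eeo).
have msG : (1 <= mstar a lam e <= Gdim lam e)%N.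
  by near: e; exact: mstar_near_le_Gdim.
have N0ms : (N0 <= mstar a lam e)%N by near: e; exact: mstar_near_oo.
have err : (Gdim lam e)%:R * expR (r / (4 * d ^+ 2) - (mstar a lam e)%:R / 8) <= x.
  by near: e; exact: dimension_error_near0.
have /andP[ms1 msG'] := msG.
move=> th K th_r th_tail K_ge; split; last first.
  by apply: postE_le1; exact: leq_trans msG'.
apply: le_trans (_ : (1 - (Gdim lam e)%:R *
    expR (r / (4 * d ^+ 2) - (mstar a lam e)%:R / 8))%:E <= _)%E.
  by rewrite lee_fin lerB.
apply: (postE_lower_bound hxi (Ll := Ll) (rho := rho) (kap := kappastar a lam eo)
  (D := D)) => //.
- by move=> j j1; exact: htau.
- by move=> j jG; exact: hA.
- exact: Phistar_ge_var.
- by apply: kappastar_le; rewrite e0.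
- by move=> j; exact: hEi.
- move=> n msn; apply: le_trans (th_tail _ n ms1 _) _; first by rewrite N0ms.
  by rewrite ler_wpM2l// Phistar_ge_a.
- by apply: LamMaxM => //; exact: ltnW.
Unshelve. all: by end_near. Qed.

End concentration.

(** * Partial sums and tails on the ellipsoid *)

Section ellipsoid.
Variables (eta th : nat -> R) (r : R).
Hypothesis a1 : a 1%N = 1.
Hypothesis hth : inTheta a eta r th.

Let term0 j : (1 <= j)%N -> 0 <= (th j - eta j) ^+ 2 / a j.
Proof. by move=> j1; rewrite divr_ge0 ?sqr_ge0// ltW// a_gt0. Qed.

Lemma inTheta_partial_sum n : \sum_(1 <= j < n) (th j - eta j) ^+ 2 / a j <= r.
Proof.
rewrite -lee_fin -sumEFin; apply: le_trans hth; apply: nneseries_lim_ge => j j1 _.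
by rewrite lee_fin term0.
Qed.

Lemma sum_sqr_le_weighted m n : (1 <= m)%N ->
  \sum_(m.+1 <= j < n.+1) (th j - eta j) ^+ 2 <=
  a m * \sum_(m.+1 <= j < n.+1) (th j - eta j) ^+ 2 / a j.
Proof.
move=> m1; rewrite mulr_sumr big_nat_cond [leRHS]big_nat_cond.
apply: ler_sum => j /andP[/andP[mj _] _]; have j1 : (1 <= j)%N by exact: leq_trans mj.
have aj := a_gt0 j1; have am : a j <= a m by rewrite a_mono// m1 ltnW.
rewrite mulrCA -[leLHS]mulr1 ler_wpM2l ?sqr_ge0// ler_pdivlMr// mul1r.
exact: am.
Qed.

Lemma inTheta_sum_sqr n : \sum_(1 <= j < n.+1) (th j - eta j) ^+ 2 <= r.
Proof.
apply: le_trans (inTheta_partial_sum n.+1).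
rewrite big_nat_cond [leRHS]big_nat_cond; apply: ler_sum => j /andP[/andP[j1 _] _].
rewrite -[leLHS]mulr1 ler_wpM2l ?sqr_ge0// -[leLHS]invr1 lef_pV2 ?posrE ?a_gt0//.
by rewrite -a1 a_mono.
Qed.

Let weighted_split m n : (m <= n)%N ->
  \sum_(1 <= j < n.+1) (th j - eta j) ^+ 2 / a j =
  \sum_(1 <= j < m.+1) (th j - eta j) ^+ 2 / a j +
  \sum_(m.+1 <= j < n.+1) (th j - eta j) ^+ 2 / a j.
Proof. by move=> mn; rewrite (@big_cat_nat _ _ _ m.+1). Qed.

Let weighted_ge0 m n : 0 <= \sum_(m.+1 <= j < n.+1) (th j - eta j) ^+ 2 / a j.
Proof.
rewrite big_nat_cond sumr_ge0// => j /andP[/andP[mj _] _].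
by rewrite term0// (leq_trans _ mj).
Qed.

Lemma inTheta_tail m n : (1 <= m)%N -> (m <= n)%N ->
  \sum_(m.+1 <= j < n.+1) (th j - eta j) ^+ 2 <= r * a m.
Proof.
move=> m1 mn; apply: le_trans (sum_sqr_le_weighted n m1) _.
rewrite mulrC ler_wpM2r ?(ltW (a_gt0 m1))//.
apply: le_trans (inTheta_partial_sum n.+1).
by rewrite (weighted_split mn) lerDr; exact: weighted_ge0.
Qed.

(** The weighted partial sums increase to a finite supremum; from an index within [rho] of it, later
    increments stay below [rho]. This index depends on [th]. *)
Lemma inTheta_small_tail rho : 0 < rho -> exists N0 : nat, forall m n,
  (1 <= m)%N -> (N0 <= m <= n)%N ->
  \sum_(m.+1 <= j < n.+1) (th j - eta j) ^+ 2 <= rho * a m.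
Proof.
move=> rho0; pose u n := \sum_(1 <= j < n.+1) (th j - eta j) ^+ 2 / a j.
have supu : has_sup (range u).
  split; first by exists (u 0%N); exists 0%N.
  by exists r => _ [n _ <-]; exact: inTheta_partial_sum.
have [_ [N0 _ <-] uN0] := sup_adherent rho0 supu.
exists N0 => m n m1 /andP[N0m mn].
apply: le_trans (sum_sqr_le_weighted n m1) _.
rewrite mulrC ler_wpM2r ?(ltW (a_gt0 m1))//.
have un : u n <= sup (range u) by apply: ub_le_sup; [case: supu|exists n].
have um : u N0 <= u m.
  by rewrite /u (weighted_split N0m) lerDl; exact: weighted_ge0.
have := weighted_split mn; rewrite -/(u n) -/(u m).
move: uN0 un um; move: (sup _) (u n) (u m) (u N0) => s1 s2 s3 s4.
by move: (\sum_(_ <= _ < _) _) => s5; lra.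
Qed.

End ellipsoid.
End asymptotics.

(** * Choice of [rho] and [D] for the two assertions *)

Unset Implicit Arguments.
Set Strict Implicit.

Theorem mainTheorem16 (R : realType)
  (lam eta : nat -> R) (tau : R -> nat -> R) (a : nat -> R)
  (eo d Cl Ll r : R)
  (* lambda bounded, nonzero *)
  (hlam_bdd : exists B : R, forall j, `|lam j| <= B)
  (hlam_nz : forall j, (1 <= j)%N -> lam j != 0)
  (* prior variances in (0, oo) *)
  (htau : forall (e : R) j, 0 < e < 1 -> (1 <= j)%N -> 0 < tau e j)
  (* the sequence a *)
  (ha_pos : forall j, (1 <= j)%N -> 0 < a j)
  (ha_mono : forall i j, (1 <= i <= j)%N -> a j <= a i)
  (ha1 : a 1%N = 1)
  (ha0 : a n @[n --> \oo] --> 0)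
  (heo : 0 < eo < 1)
  (* Assumption A *)
  (hd : 0 < d)
  (hA : forall (e : R) j, 0 < e < 1 -> (1 <= j <= Gdim lam e)%N ->
          d * Num.max (Num.sqrt e * Num.sqrt (Lam lam j)) (e * Lam lam j) <= tau e j)
  (* Assumption E *)
  (hCl : 1 <= Cl) (hLl : 1 <= Ll)
  (hEi : forall k, (1 <= k)%N -> forall j, (k < j)%N ->
           lam j ^+ 2 <= Cl * (LamMax lam k)^-1)
  (hEii : forall k l, (1 <= k)%N -> (1 <= l)%N ->
           LamMax lam (k * l) <= LamMax lam k * LamMax lam l)
  (hEiii : forall k, (1 <= k)%N -> LamMax lam k / LamBar lam k <= Ll)
  (* Assumption M *)
  (hM : 0 < kappastar a lam eo)
  (hr : 0 < r)
  (hlog : ln ((Gdim lam e)%:R : R) / (mstar a lam e)%:R @[e --> (0:R)^'+] --> (0:R))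
  (dT : measure_display) (T : measurableType dT) (P : probability T R)
  (xi : nat -> T -> R) (hxi : iid_std_normal P xi) :
  (forall th : nat -> R, inTheta a eta r th ->
     postE P xi a lam eta tau Cl th (Kstar a lam eo d r Cl Ll) e
       @[e --> (0:R)^'+] --> 1%E)
  /\
  (forall K : R -> R,
     (forall e : R, 0 < e < 1 -> 0 < K e) ->
     (forall e1 e2 : R, 0 < e1 -> e1 <= e2 -> e2 < 1 -> K e2 <= K e1) ->
     (K e)%:E @[e --> (0:R)^'+] --> +oo%E ->
     ereal_inf [set postE P xi a lam eta tau Cl th (K e) e | th in inTheta a eta r]
       @[e --> (0:R)^'+] --> 1%E).
Proof.
set kap := kappastar a lam eo in hM *.
have kap1 : kap <= 1 by apply: (kappastar_le1 (Ll := Ll)).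
have Ll0 : 0 < Ll by exact: lt_le_trans hLl.
have near1 := @postE_near1 R a lam eo Ll hlam_nz ha_pos ha_mono ha0 heo hLl hEii
  hEiii eta tau d Cl r htau hd hA hCl hEi hlog dT T P xi hxi.
split=> [th hth|K K0 Kmono Koo].
  pose D := Dstar a lam eo Ll.
  have D5 : 5 <= D%:R :> R.
    apply: (@le_trans _ _ (5 * Ll / kap)).
      by rewrite ler_pdivlMr// ler_wpM2l// (le_trans kap1).
    apply: le_trans (ceil_ge _) _.
    by rewrite /D /Dstar natr_absz ler_int ler_norm.
  have D2 : (2 <= D)%N by rewrite -(ler_nat R) (le_trans _ D5)// ler_nat.
  (* With [rho] equal to [kap], the condition [4 * rho <= kap * (D - 1)] becomes [5 <= D]. *)
  have [N0 hN0] := inTheta_small_tail ha_pos ha_mono hth hM.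
  apply: cvge_to_1 => x x0.
  have rho_le : 4 * kap <= kap * (D%:R - 1).
    by rewrite mulrC; apply: ler_wpM2l; [exact: ltW|lra].
  apply: filterS (near1 kap D N0 x x0 (ltW hM) D2 rho_le) => e; apply.
  - by move=> n; exact: (inTheta_sum_sqr ha_pos ha_mono ha1 hth).
  - exact: hN0.
  (* The factors [M1] and [M3] are only used through [1 <= M1] and [1 <= M3]:
     [16 * Ll * M2] already dominates the three terms. *)
  rewrite /Kstar -/D; set M1 := Num.max _ _; set M2 := Num.max _ _; set M3 := Num.max _ _.
  have dV0 : 0 < d^-1 by rewrite invr_gt0.
  have M11 : 1 <= M1 by rewrite le_max lerDl (ltW dV0).
  have M31 : 1 <= M3 by rewrite le_max lexx.
  have LMD0 : 0 < LamMax lam D by apply: LamMax_gt0 => //; exact: ltnW.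
  have M2x : 8 * Cl * (1 + d^-1) <= M2 by rewrite le_max lexx.
  have M2y : D%:R * LamMax lam D <= M2 by rewrite le_max lexx orbT.
  have Cd1 : 1 <= Cl * (1 + d^-1).
    by rewrite -[leLHS]mulr1 ler_pM// lerDl ltW.
  have M20 : 8 <= M2 by apply: le_trans M2x; rewrite -mulrA; lra.
  have M2pos : 0 <= M2 by apply: le_trans M20.
  have LlM2 : 0 <= Ll * M2 by rewrite mulr_ge0// ltW.
  apply: (@le_trans _ _ (16 * (Ll * M2))); last first.
    have -> : 16 * M1 * Ll ^+ 2 * M2 * M3 = (M1 * (Ll * M3)) * (16 * (Ll * M2)).
      by ring.
    rewrite -[leLHS]mul1r ler_wpM2r ?mulr_ge0 ?(ltW Ll0)//.
    by rewrite -[leLHS]mulr1 ler_pM// -[leLHS]mulr1 ler_pM.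
  have h1 := ler_wpM2l (ltW Ll0) M2x; have h2 := ler_wpM2l (ltW Ll0) M2y.
  have h3 := ler_pM ler01 (ler0n R 8) hLl M20.
  have -> : 8 * Ll * LamMax lam D * D%:R = 8 * (Ll * (D%:R * LamMax lam D)) by ring.
  have -> : 8 * Cl * (1 + d^-1) * Ll = Ll * (8 * Cl * (1 + d^-1)) by ring.
  move: h1 h2 h3; move: (Ll * (8 * _ * _)) (Ll * (D%:R * _)) (Ll * M2) => z1 z2 z3.
  by lra.
(* Uniformly over the ellipsoid only [rho = r] is available, so [D] grows with [r / kap]. The
   resulting [Kc] depends neither on [e] nor on [th] and is eventually below [K e]. *)
pose D := (Num.truncn (4 * r / kap)).+2.
have rho_le : 4 * r <= kap * (D%:R - 1).
  have -> : D%:R - 1 = (Num.truncn (4 * r / kap)).+1%:R :> R.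
    by rewrite /D -natr1 addrK.
  by rewrite [leRHS]mulrC -ler_pdivrMr// ltW// truncnS_gt.
pose Kc := 8 * Ll * LamMax lam D * D%:R + 8 * Cl * (1 + d^-1) * Ll + r.
have KcK : \forall e \near (0 : R)^'+, (Kc%:E <= (K e)%:E)%E.
  by move/cvgeyPge: Koo; apply.
apply: cvge_to_1 => x x0.
have Hn := near1 r D 0%N x x0 (ltW hr) isT rho_le.
apply: filterS2 Hn KcK => e He; rewrite lee_fin => Kce.
have bnd th : inTheta a eta r th ->
    ((1 - x)%:E <= postE P xi a lam eta tau Cl th (K e) e /\
     postE P xi a lam eta tau Cl th (K e) e <= 1)%E.
  move=> hth; apply: He Kce.
  - exact: (inTheta_sum_sqr ha_pos ha_mono ha1 hth).
  - by move=> m n m1 /andP[_ mn]; exact: (inTheta_tail ha_pos ha_mono hth).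
split.
  by apply/ereal_infP => _ [th hth <-]; have [] := bnd th hth.
(* The centre shows that the infimum runs over a nonempty set, hence is at most 1. *)
have heta : inTheta a eta r eta.
  rewrite /inTheta eseries0; first by rewrite lee_fin ltW.
  by move=> j _ _; rewrite subrr expr0n mul0r.
apply: ge_ereal_inf; exists (postE P xi a lam eta tau Cl eta (K e) e).
  by exists eta.
by have [] := bnd eta heta.
Qed.
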